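(* The action $\mathcal{I}$ is invariant under post-composition by elements of $\mathrm{PSL}(2,\mathbb{R})$: for any $\psi\in\mathrm{PSL}(2,\mathbb{R})$ and any $\phi\in\mathsf{H}(\mathbb{T})$, $$\mathcal{I}(\psi\circ\phi)=\mathcal{I}(\phi).$$
   Context: $\mathbb{T}=[0,1]/\{0\sim1\}$ is the unit circle. $\mathrm{Diff}^1(\mathbb{T})$ is the space of orientation preserving $C^1$-diffeomorphisms of $\mathbb{T}$ (identified with $C^1$ maps $\phi:\mathbb{R}\to\mathbb{R}$, modulo integer constants, with $\phi(\tau+1)=\phi(\tau)+1$, $\phi'>0$). $\mathsf{H}(\mathbb{T})=\{\phi\in\mathrm{Diff}^1(\mathbb{T}):\log\phi'\in H^1(\mathbb{T})\}$, where $H^1(\mathbb{T})$ is the Sobolev space. The action is $$\mathcal{I}(\phi)=\frac12\int_{\mathbb{T}}\left[\big((\log\phi'(\tau))'\big)^2-4\pi^2\phi'(\tau)^2\right]d\tau\ \text{ for }\phi\in\mathsf{H}(\mathbb{T}),\qquad \mathcal{I}(\phi)=\infty\ \text{ otherwise},$$ where $(\log\phi')'$ is the weak derivative. $\mathrm{PSL}(2,\mathbb{R})$ is the group of conformal automorphisms of the unit disk restricted to the boundary, identified with $\mathbb{T}$ via $t\mapsto e^{2\pi i t}$. *)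

(* Defs.v *)
From HB Require Import structures.
From mathcomp Require Import all_boot all_order all_algebra.
From mathcomp Require Import complex.
From mathcomp Require Import all_classical all_reals all_analysis.

Set Implicit Arguments.
Unset Strict Implicit.
Unset Printing Implicit Defensive.

Import Order.TTheory GRing.Theory Num.Theory.
Import numFieldNormedType.Exports.

Local Open Scope classical_set_scope.
Local Open Scope ring_scope.

(* The circle is R/Z.  A function on the circle is a 1-periodic function on R,
   and a homeomorphism of the circle is given by one of its lifts R -> R, any
   two of which differ by an integer constant. *)

Definition unit_interval (R : realType) : set R := `[0, 1].
Arguments unit_interval : clear implicits.

Definition periodic1 (R : realType) (f : R -> R) : Prop :=
  forall t, f (t + 1) = f t.

Definition circle_diffeo1 (R : realType) (phi : R -> R) : Prop :=
  [/\ forall t, derivable phi t 1,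
      continuous (derive1 phi),
      forall t, phi (t + 1) = phi t + 1
    & forall t, 0 < derive1 phi t].

Definition circle_test_fun (R : realType) (chi : R -> R) : Prop :=
  periodic1 chi /\ forall n t, derivable (derive1n n chi) t 1.

Definition circle_L2 (R : realType) (f : R -> R) : Prop :=
  measurable_fun (unit_interval R) f /\
  lebesgue_measure.-integrable (unit_interval R) (fun t => (f t ^+ 2)%:E).

(* The test functions live on the circle, so there are no boundary terms; only
   the values of [g] on [0, 1] matter, and they are determined up to a null
   set. *)
Definition is_weak_derivative (R : realType) (f g : R -> R) : Prop :=
  lebesgue_measure.-integrable (unit_interval R) (EFin \o g) /\
  forall chi : R -> R, circle_test_fun chi ->
    \int[lebesgue_measure]_(t in unit_interval R) (f t * derive1 chi t) =
    - \int[lebesgue_measure]_(t in unit_interval R) (g t * chi t).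

(* Some weak derivative of [f], and 0 if there is none. *)
Definition weak_derivative (R : realType) (f : R -> R) : R -> R :=
  xget (cst 0) [set g | is_weak_derivative f g].

Definition circle_H1 (R : realType) (f : R -> R) : Prop :=
  [/\ periodic1 f, circle_L2 f
    & exists2 g : R -> R, is_weak_derivative f g & circle_L2 g].

Definition log_deriv (R : realType) (phi : R -> R) : R -> R :=
  fun t => ln (derive1 phi t).

Definition H_diffeo (R : realType) (phi : R -> R) : Prop :=
  circle_diffeo1 phi /\ circle_H1 (log_deriv phi).

Definition action (R : realType) (phi : R -> R) : \bar R :=
  if `[< H_diffeo phi >] then
    ((2^-1)%:E * \int[lebesgue_measure]_(t in unit_interval R)
      ((weak_derivative (log_deriv phi) t) ^+ 2
        - 4 * pi ^+ 2 * (derive1 phi t) ^+ 2)%:E)%E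
  else +oo%E.

(* [R[i]^o] rather than [R[i]]: only the former carries the topology and the
   normed-module structure over the field [R[i]].  In particular [derivable]
   below is complex differentiability. *)
Definition unit_disk (R : realType) : set R[i]^o := [set z | `|z| < 1].
Arguments unit_disk : clear implicits.

Definition holomorphic_on (R : realType) (D : set R[i]^o)
    (F : R[i]^o -> R[i]^o) : Prop :=
  forall z, D z -> derivable F z 1.

Definition disk_automorphism (R : realType) (F : R[i]^o -> R[i]^o) : Prop :=
  let D := unit_disk R in
  exists G : R[i]^o -> R[i]^o,
    [/\ holomorphic_on D F, holomorphic_on D G,
        forall z, D z -> D (F z) /\ G (F z) = z
      & forall z, D z -> D (G z) /\ F (G z) = z].

Definition circle_exp (R : realType) (t : R) : R[i]^o :=
  (cos (2 * pi * t) +i* sin (2 * pi * t))%C.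

(* [psi] is a (continuous) lift of the boundary values of a conformal
   automorphism of the unit disk.  Being C^1 with [psi (t + 1) = psi t + 1] and
   [psi' > 0] is a consequence and is not assumed. *)
Definition PSL2R (R : realType) (psi : R -> R) : Prop :=
  continuous psi /\
  exists2 F : R[i]^o -> R[i]^o, disk_automorphism F
    & forall t, F z @[z --> within (unit_disk R) (nbhs (circle_exp t))]
                  --> circle_exp (psi t).

(* Main.v *)
Require Import Defs.
From HB Require Import structures.
From mathcomp Require Import all_boot all_order all_algebra.
From mathcomp Require Import complex.
From mathcomp Require Import all_classical all_reals all_analysis.
From mathcomp Require Import measurable_realfun ring lra.

(* A disk automorphism is a Moebius map: by Goursat's theorem in the coordinate
   log z the mean of F(z) / z over |z| = r does not depend on r, so that
   |F'(0)| <= 1 when F(0) = 0; conjugating by Moebius maps gives the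
   Schwarz-Pick inequality, and integrating it along rays gives |F(z)| <= |z|,
   with equality for automorphisms, which forces F(z) = c z.  On the circle the
   lift psi then has for derivative the Poisson kernel P.
   Write L = ln P, w = ln phi', and let g be the weak derivative of w.  The weak
   derivative of ln (psi o phi)' = L(phi) + w is L'(phi) phi' + g, and
   integrating 2 g L'(phi) phi' by parts (the weak derivative of phi' = e^w being
   g e^w) turns the difference of the two actions into half the integral of
     phi'^2 (L'^2 - 2 L'' - 4 pi^2 (P^2 - 1)) (phi),
   whose integrand vanishes: this is the Moebius invariance of the Schwarzian
   derivative. *)

Set Implicit Arguments.
Unset Strict Implicit.
Unset Printing Implicit Defensive.

Import Order.TTheory GRing.Theory Num.Theory.
Import numFieldNormedType.Exports.

Local Open Scope classical_set_scope.
Local Open Scope ring_scope.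

(** * Goursat's theorem *)

(** [holomorphic_on] gives complex differentiability at each point, without continuity of the
    derivative; hence a bisection argument rather than Green's formula. In the coordinate log z
    circles become vertical segments, so rectangles are the only contours needed. A mean over
    circles only sees the centre: this is why F'(0) is bounded before F, and why Moebius maps carry
    the bound to the other points. The weak derivative g is merely integrable and known only through
    test functions. Integrations by parts against it are done by approximating g in L^1 by
    continuous functions, whose primitives approximate that of g uniformly on [0, 1]. The constant 4
    pi^2 comes from the Schwarzian S: L'^2 - 2 L'' is -2 S(psi), tan (pi t) has constant Schwarzian
    2 pi^2, and tan (pi psi) is a real Moebius transform of tan (pi t). The composition rule then
    gives -2 S(psi) = 4 pi^2 (P^2 - 1). *)

Section integral_on_segments.
Context {R : realType}.
Notation mu := (@lebesgue_measure R).
Implicit Types (f g F : R -> R) (a b c M : R).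

Lemma continuous_integrable_cc f a b :
  continuous f -> mu.-integrable `[a, b] (EFin \o f).
Proof.
move=> cf; apply: continuous_compact_integrable; first exact: segment_compact.
exact: continuous_subspaceT.
Qed.

Lemma Rintegral_cc_split f a b c : continuous f -> a <= c -> c <= b ->
  \int[mu]_(x in `[a, b]) f x =
  \int[mu]_(x in `[a, c]) f x + \int[mu]_(x in `[c, b]) f x.
Proof.
move=> cf ac cb.
have := @Rintegral_itvB _ f (BLeft a) (BRight b) c.
rewrite !bnd_simp => /(_ (continuous_integrable_cc _ _ cf) ac cb).
rewrite Rintegral_itv_obnd_cbnd; last first.
  apply: integrableS (continuous_integrable_cc c b cf) => //.
  exact: subset_itv_oc_cc.
by move=> <-; rewrite addrC subrK.
Qed.

Lemma Rintegral_cc_FTC F f a b : continuous f -> a <= b ->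
  (forall x : R, is_derive x (1 : R) F (f x)) ->
  \int[mu]_(x in `[a, b]) f x = F b - F a.
Proof.
move=> cf; rewrite le_eqVlt => /orP[/eqP ->|ab] dF.
  by rewrite set_itv1 Rintegral_set1 subrr.
have cF : continuous F.
  by move=> x; apply: differentiable_continuous; apply/derivable1_diffP; have [] := dF x.
rewrite /Rintegral (@continuous_FTC2 _ f F a b) //=.
- exact: continuous_subspaceT.
- by split => [x _||]; [by have [] := dF x|exact: cvg_at_right_filter (cF _)|
    exact: cvg_at_left_filter (cF _)].
- by move=> x _; rewrite derive1E; apply: derive_val; exact: dF.
Qed.

Lemma Rintegral_cc_cst a b (k : R) : a <= b ->
  \int[mu]_(x in `[a, b]) k = k * (b - a).
Proof.
move=> ab; have ck : continuous (fun _ : R => k) by move=> x; exact: cvg_cst.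
have -> : k * (b - a) = k * b - k * a by ring.
apply: (Rintegral_cc_FTC (F := fun x => k * x)) => // x.
by apply: is_derive_eq; rewrite /GRing.scale /= mulr1.
Qed.

Lemma Rintegral_cc_le f a b M : continuous f -> a <= b ->
  (forall x, a <= x <= b -> f x <= M) ->
  \int[mu]_(x in `[a, b]) f x <= M * (b - a).
Proof.
move=> cf ab fM.
have cM : continuous (fun _ : R => M) by move=> x; exact: cvg_cst.
apply: (@le_trans _ _ (\int[mu]_(x in `[a, b]) M)).
  apply: le_Rintegral => //; try exact: continuous_integrable_cc.
by rewrite (Rintegral_cc_cst M ab).
Qed.

Lemma Rintegral_cc_ge f a b M : continuous f -> a <= b ->
  (forall x, a <= x <= b -> M <= f x) ->
  M * (b - a) <= \int[mu]_(x in `[a, b]) f x.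
Proof.
move=> cf ab fM.
have cM : continuous (fun _ : R => M) by move=> x; exact: cvg_cst.
rewrite -(Rintegral_cc_cst M ab).
by apply: le_Rintegral => //; exact: continuous_integrable_cc.
Qed.

Lemma Rintegral_cc_bound f a b M : continuous f -> a <= b ->
  (forall x, a <= x <= b -> `|f x| <= M) ->
  `|\int[mu]_(x in `[a, b]) f x| <= M * (b - a).
Proof.
move=> cf ab fM; apply: le_trans (le_normr_Rintegral _ _) _ => //.
  exact: continuous_integrable_cc.
by apply: Rintegral_cc_le => // x; apply: continuous_comp;
  [exact: cf|exact: norm_continuous].
Qed.

(** The estimate behind Goursat's theorem: along a side of a small rectangle [f] is compared with an
    affine [f0], whose primitive is explicit. *)
Lemma Rintegral_cc_approx f f0 F a b M : continuous f -> continuous f0 ->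
  a <= b -> (forall x : R, is_derive x (1 : R) F (f0 x)) ->
  (forall x, a <= x <= b -> `|f x - f0 x| <= M) ->
  `|\int[mu]_(x in `[a, b]) f x - (F b - F a)| <= M * (b - a).
Proof.
move=> cf cf0 ab dF fM.
rewrite -(Rintegral_cc_FTC cf0 ab dF).
rewrite -RintegralB //; try exact: continuous_integrable_cc.
apply: Rintegral_cc_bound => // x; apply: cvgB; [exact: cf|exact: cf0].
Qed.

End integral_on_segments.

Section goursat.
Context {R : realType}.
Notation mu := (@lebesgue_measure R).
Variables P Q : R -> R -> R.
Hypothesis cP : forall y, continuous (P ^~ y).
Hypothesis cQ : forall x, continuous (Q x).

(* The integral of [P dx + Q dy] along the boundary of [a, b] x [c, d]. *)
Definition boundary_integral (a b c d : R) :=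
  \int[mu]_(x in `[a, b]) P x c - \int[mu]_(x in `[a, b]) P x d
  + \int[mu]_(y in `[c, d]) Q b y - \int[mu]_(y in `[c, d]) Q a y.

(** The inner sides are traversed twice, in opposite directions, and cancel. *)
Lemma boundary_integral_split a b c d m n : a <= m <= b -> c <= n <= d ->
  boundary_integral a b c d =
  (boundary_integral a m c n + boundary_integral m b c n) +
  (boundary_integral a m n d + boundary_integral m b n d).
Proof.
move=> /andP[am mb] /andP[cn nd]; rewrite /boundary_integral.
rewrite !(Rintegral_cc_split (@cP _) am mb) !(Rintegral_cc_split (@cQ _) cn nd).
ring.
Qed.

(* [P] and [Q] are differentiable at [(p, q)] relatively to the rectangle, and
   the differential of the form [P dx + Q dy] vanishes there. *)
Definition closed_form_at (a b c d p q : R) := exists al be ga : R,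
  forall e, 0 < e -> exists2 del, 0 < del & forall x y,
    a <= x <= b -> c <= y <= d -> `|x - p| <= del -> `|y - q| <= del ->
    `|P x y - (P p q + al * (x - p) + be * (y - q))|
      <= e * (`|x - p| + `|y - q|) /\
    `|Q x y - (Q p q + be * (x - p) + ga * (y - q))|
      <= e * (`|x - p| + `|y - q|).

Lemma affine_primitive (k l p x : R) :
  is_derive x (1 : R) (fun x => k * x + l * (x - p) ^+ 2 / 2)
    (k + l * (x - p)).
Proof.
apply: is_derive_eq; rewrite /GRing.scale /= !mulr1 !mulr0 ?addr0 ?add0r.
by field.
Qed.

Lemma affine_continuous (k l p : R) : continuous (fun x : R => k + l * (x - p)).
Proof.
move=> x; apply: cvgD; first exact: cvg_cst.
by apply: cvgM; [exact: cvg_cst|apply: cvgB; [exact: cvg_id|exact: cvg_cst]].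
Qed.

(** The affine part of the form is closed, because the same [be] is the y-slope of [P] and the
    x-slope of [Q]; its boundary integral vanishes. What remains is an error of at most [e] times
    the half perimeter at each point of a contour of length twice the half perimeter. *)
Lemma small_boundary_integral a b c d p q al be ga e :
  a <= p <= b -> c <= q <= d -> 0 <= e ->
  (forall x y, a <= x <= b -> c <= y <= d ->
    `|P x y - (P p q + al * (x - p) + be * (y - q))|
      <= e * (`|x - p| + `|y - q|) /\
    `|Q x y - (Q p q + be * (x - p) + ga * (y - q))|
      <= e * (`|x - p| + `|y - q|)) ->
  `|boundary_integral a b c d| <= 2 * e * ((b - a) + (d - c)) ^+ 2.
Proof.
move=> /andP[ap pb] /andP[cq qd] e0 H.
have ab : a <= b by apply: le_trans pb.
have cd : c <= d by apply: le_trans qd.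
have small x y : a <= x <= b -> c <= y <= d ->
    e * (`|x - p| + `|y - q|) <= e * ((b - a) + (d - c)).
  move=> /andP[? ?] /andP[? ?]; apply: ler_wpM2l => //.
  by apply: lerD; rewrite ler_norml; apply/andP; split; lra.
have HP y : c <= y <= d ->
    `|\int[mu]_(x in `[a, b]) P x y
      - ((P p q + be * (y - q)) * (b - a)
         + al * ((b - p) ^+ 2 - (a - p) ^+ 2) / 2)|
    <= e * ((b - a) + (d - c)) * (b - a).
  move=> cyd.
  have := @Rintegral_cc_approx _ (P ^~ y) _ _ a b (e * ((b - a) + (d - c)))
    (@cP y) (@affine_continuous (P p q + be * (y - q)) al p) ab
    (affine_primitive _ _ _).
  move=> /(_ _)/wrap[].
    move=> x axb; have [h _] := H x y axb cyd.
    apply: le_trans (small x y axb cyd); apply: le_trans h.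
    by rewrite le_eqVlt; apply/orP; left; apply/eqP; congr (`|_|); ring.
  apply: le_trans; rewrite le_eqVlt; apply/orP; left; apply/eqP.
  by congr (`|_|); field.
have HQ x : a <= x <= b ->
    `|\int[mu]_(y in `[c, d]) Q x y
      - ((Q p q + be * (x - p)) * (d - c)
         + ga * ((d - q) ^+ 2 - (c - q) ^+ 2) / 2)|
    <= e * ((b - a) + (d - c)) * (d - c).
  move=> axb.
  have := @Rintegral_cc_approx _ (Q x) _ _ c d (e * ((b - a) + (d - c)))
    (@cQ x) (@affine_continuous (Q p q + be * (x - p)) ga q) cd
    (affine_primitive _ _ _).
  move=> /(_ _)/wrap[].
    move=> y cyd; have [_ h] := H x y axb cyd.
    by apply: le_trans (small x y axb cyd); apply: le_trans h.
  apply: le_trans; rewrite le_eqVlt; apply/orP; left; apply/eqP.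
  by congr (`|_|); field.
have := HP c; have := HP d; have := HQ a; have := HQ b.
rewrite !lexx ab cd /= => /(_ isT) h1 /(_ isT) h2 /(_ isT) h3 /(_ isT) h4.
move: h1 h2 h3 h4; rewrite /boundary_integral !ler_norml.
set I1 := \int[mu]_(_ in _) _; set I2 := \int[mu]_(_ in _) _.
set I3 := \int[mu]_(_ in _) _; set I4 := \int[mu]_(_ in _) _.
move=> /andP[? ?] /andP[? ?] /andP[? ?] /andP[? ?].
have := expr2 ((b - a) + (d - c)).
by move=> ->; apply/andP; split; lra.
Qed.

(** Bisection: some quarter of a rectangle carries at least a quarter of the boundary integral.
    Along the nested quarters the integral decreases at most like the area, whereas
    differentiability at the limit point makes it negligible against the squared diameter. *)
Theorem goursat a b c d : a <= b -> c <= d ->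
  (forall p q, a <= p <= b -> c <= q <= d -> closed_form_at a b c d p q) ->
  boundary_integral a b c d = 0.
Proof.
move=> ab cd H; apply/eqP; rewrite -normr_le0 leNgt; apply/negP.
set K := `|_| => K0.
pose h n : R := 2^-1 ^+ n.
have hS n : h n = h n.+1 + h n.+1 by rewrite /h exprS; lra.
have h0 n : 0 <= h n by apply: exprn_ge0; lra.
pose xe (n : nat) (z : R * R) := z.1 + (b - a) * h n.
pose ye (n : nat) (z : R * R) := z.2 + (d - c) * h n.
pose B n z := boundary_integral z.1 (xe n z) z.2 (ye n z).
pose big n z := K * h n ^+ 2 <= `|B n z|.
pose nested n (z z' : R * R) := [/\ z.1 <= z'.1, xe n.+1 z' <= xe n z,
  z.2 <= z'.2 & ye n.+1 z' <= ye n z].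
have ba0 : 0 <= b - a by lra.
have dc0 : 0 <= d - c by lra.
(* The hypothesis [big n z] sits under the existential, so that a successor exists for every [z] and
   the recursion below needs no proof argument. *)
have step n z : exists z', big n z -> big n.+1 z' /\ nested n z z'.
  have wh := mulr_ge0 ba0 (h0 n.+1); have hh := mulr_ge0 dc0 (h0 n.+1).
  have [bg|] := pselect (big n z); last by exists z.
  set x := z.1; set y := z.2; set x' := x + (b - a) * h n.+1.
  set y' := y + (d - c) * h n.+1.
  have ex : xe n z = x' + (b - a) * h n.+1 by rewrite /xe /x' hS; ring.
  have ey : ye n z = y' + (d - c) * h n.+1 by rewrite /ye /y' hS; ring.
  have : [\/ big n.+1 (x, y), big n.+1 (x', y), big n.+1 (x, y')
           | big n.+1 (x', y')].
    move: bg; rewrite /big /B.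
    rewrite (@boundary_integral_split _ _ _ _ x' y'); last 2 first.
    - by rewrite ex /x'; apply/andP; split; lra.
    - by rewrite ey /y'; apply/andP; split; lra.
    rewrite ex ey {1 2 3 4}/xe {1 2 3 4}/ye /= -/x -/y -/x' -/y'.
    set b1 := boundary_integral x x' y y'.
    set b2 := boundary_integral x' _ y y'.
    set b3 := boundary_integral x x' y' _.
    set b4 := boundary_integral x' _ y' _ => bg.
    set k := K * _; have [|g1] := leP k `|b1|; first by constructor 1.
    have [|g2] := leP k `|b2|; first by constructor 2.
    have [|g3] := leP k `|b3|; first by constructor 3.
    have [|g4] := leP k `|b4|; first by constructor 4.
    have := le_trans bg (ler_normD _ _).
    have := ler_normD b1 b2; have := ler_normD b3 b4.
    have -> : K * h n ^+ 2 = k + k + k + k by rewrite hS /k; ring.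
    by lra.
  by case=> g; [exists (x, y)|exists (x', y)|exists (x, y')|exists (x', y')];
    move=> _; split=> //; split; rewrite /= ?ex ?ey /xe /ye /= -/x -/y;
    rewrite /x' /y'; lra.
(* The default [u m] of [xget] is never taken, since [step] always provides a witness. *)
pose u := fix u n : R * R := if n is m.+1 then
  xget (u m) [set z' | big m (u m) -> big m.+1 z' /\ nested m (u m) z']
  else (a, c).
have uS n : big n (u n) -> big n.+1 (u n.+1) /\ nested n (u n) (u n.+1).
  have hex := step n (u n); rewrite [u n.+1]/=.
  by case: xgetP => [z _ //|nex]; case: hex => z /(nex z).
have ubig n : big n (u n).
  elim: n => [|n /uS[]//]; rewrite /big /B /xe /ye /h /= expr0 expr1n !mulr1.
  by rewrite ![_ + (_ - _)]addrC !subrK.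
have unest n : nested n (u n) (u n.+1) by have [] := uS _ (ubig n).
have limit (v g : nat -> R) : (forall n, v n <= v n.+1) ->
    (forall n, g n.+1 <= g n) -> (forall n, v n <= g n) ->
    exists p, forall n, v n <= p <= g n.
  move=> vn gn vg.
  have vm : {homo v : m n / (m <= n)%N >-> m <= n}.
    exact: (homo_leq (@lexx _ _) (@le_trans _ _)).
  have gm : {homo g : m n / (m <= n)%N >-> n <= m}.
    by apply: (homo_leq (@lexx _ _) (fun y x z h1 h2 => le_trans h2 h1)).
  have vgmn m n : v m <= g n.
    have [mn|/ltnW nm] := leqP m n.
      exact: le_trans (vm _ _ mn) (vg n).
    exact: le_trans (vg m) (gm _ _ nm).
  have sv : has_sup (range v).
    split; first by exists (v 0%N); exists 0%N.
    by exists (g 0%N) => _ [m _ <-].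
  exists (sup (range v)) => n; apply/andP; split.
    by apply: ub_le_sup; [by case: sv|exists n].
  by apply: ge_sup; [by case: sv|move=> _ [m _ <-]].
have [p hp] : exists p, forall n, (u n).1 <= p <= xe n (u n).
  apply: (limit (fun n => (u n).1) (fun n => xe n (u n))) => n.
  - by have [] := unest n.
  - by have [] := unest n.
  - by rewrite /xe lerDl mulr_ge0.
have [q hq] : exists q, forall n, (u n).2 <= q <= ye n (u n).
  apply: (limit (fun n => (u n).2) (fun n => ye n (u n))) => n.
  - by have [] := unest n.
  - by have [] := unest n.
  - by rewrite /ye lerDl mulr_ge0.
have inrect n : [/\ a <= (u n).1, xe n (u n) <= b, c <= (u n).2
    & ye n (u n) <= d].
  elim: n => [|n [i1 i2 i3 i4]].
    rewrite /xe /ye /h /= expr0 !mulr1; split => //; lra.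
  have [j1 j2 j3 j4] := unest n.
  by split; [apply: le_trans j1|apply: le_trans i2|apply: le_trans j3
    |apply: le_trans i4].
pose L := (b - a) + (d - c).
have L0 : 0 <= L by rewrite addr_ge0.
have [al [be [ga]]] : closed_form_at a b c d p q.
  have := hp 0%N; have := hq 0%N; have [] := inrect 0%N => ? ? ? ?.
  move=> /andP[? ?] /andP[? ?].
  by apply: H; apply/andP; split; lra.
(* Chosen so that 2 e L^2 < K; the added 1 keeps the denominator positive when the rectangle is a
   point. *)
pose e := K / (4 * (L ^+ 2 + 1)).
have L20 : 0 < 4 * (L ^+ 2 + 1) by have := sqr_ge0 L; lra.
have e0 : 0 < e by apply: divr_gt0.
move=> /(_ e e0)[del del0 Hdel].
have [n hn] : exists n, L * h n <= del.
  have : h n @[n --> \oo] --> (0 : R).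
    by apply: cvg_expr; rewrite ger0_norm; lra.
  move=> /(cvgMl_tmp (a := L)); rewrite mulr0 => /cvgrPdist_le /(_ _ del0) [N _ hN].
  exists N; have := hN N (leqnn N); rewrite /= sub0r normrN ger0_norm //.
  by rewrite mulr_ge0.
have := ubig n; apply/negP; rewrite -ltNge.
have [i1 i2 i3 i4] := inrect n.
have /andP[p1 p2] := hp n; have /andP[q1 q2] := hq n.
have whn : (b - a) * h n + (d - c) * h n <= del.
  by apply: le_trans hn; rewrite /L; lra.
have w0 := mulr_ge0 ba0 (h0 n); have hh0 := mulr_ge0 dc0 (h0 n).
have := @small_boundary_integral _ _ _ _ p q al be ga e (hp n) (hq n) (ltW e0).
move=> /(_ _)/wrap[].
  move=> x y /andP[x1 x2] /andP[y1 y2].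
  move: x2 y2 p2 q2 i2 i4; rewrite /xe /ye => x2 y2 p2 q2 i2 i4.
  by apply: Hdel; rewrite ?ler_norml; apply/andP; split; lra.
move=> le; apply: le_lt_trans le _.
have -> : (xe n (u n) - (u n).1) + (ye n (u n) - (u n).2) = L * h n.
  by rewrite /xe /ye /L; ring.
rewrite exprMn mulrA ltr_pM2r; last by apply: exprn_gt0; apply: exprn_gt0; lra.
rewrite /e mulrAC mulrA ltr_pdivrMr //.
have := sqr_ge0 L; nra.
Qed.

End goursat.

(** * Complex derivatives *)

Section numfield_derivative.
Context {K : numFieldType}.
Implicit Types (f g : K -> K) (x d : K).

Lemma nf_is_derive_comp f g x (df dg : K) :
  is_derive (g x) (1 : K) f df -> is_derive x (1 : K) g dg ->
  is_derive x (1 : K) (f \o g) (df * dg).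
Proof.
move=> [Df Ef] [Dg Eg].
have Dfd : differentiable f (g x) by apply/derivable1_diffP.
have Dgd : differentiable g x by apply/derivable1_diffP.
have Dfg : differentiable (f \o g) x by exact: differentiable_comp.
apply: DeriveDef; first by apply/derivable1_diffP.
rewrite -derive1E derive1E' // diff_comp //= diff1E // diff1E // !derive1E.
by rewrite Ef Eg /GRing.scale /= mul1r mulrC.
Qed.

Lemma nf_is_deriveV f x (df : K) : f x != 0 ->
  is_derive x (1 : K) f df ->
  is_derive x (1 : K) (fun y => (f y)^-1) (- df / f x ^+ 2).
Proof.
move=> fx [Df <-]; apply: DeriveDef; first exact: derivableV.
by rewrite deriveV // /GRing.scale /= mulNr mulrC mulNr.
Qed.

(** First-order expansion without quotient: h = 0 needs no exception, and expansions over the reals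
    and over the complex numbers can be combined. *)
Lemma nf_is_deriveP f x d : is_derive x (1 : K) f d <-> forall e : K, 0 < e ->
  exists2 del : K, 0 < del & forall h, `|h| < del ->
    `|f (x + h) - (f x + d * h)| <= e * `|h|.
Proof.
split.
  move=> [df <-] e e0.
  have /cvgrPdist_le /(_ _ e0) /= := df.
  move=> /nbhs_ballP[del del0 /= H]; exists del => // h hdel.
  have [->|h0] := eqVneq h 0; first by rewrite mulr0 !addr0 subrr normr0 mulr0.
  have := H h; rewrite /ball /= sub0r normrN => /(_ hdel h0).
  rewrite [h *: 1]mulr1.
  rewrite /GRing.scale /= => le.
  have -> : f (x + h) - (f x + 'D_1 f x * h) =
     - (('D_1 f x - h^-1 * (f (h + x) - f x)) * h).
    by rewrite mulrBl mulrAC mulVf // mul1r (addrC h x); ring.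
  by rewrite normrN normrM ler_wpM2r.
move=> H.
have L : h^-1 *: (f (h *: (1 : K) + x) - f x) @[h --> 0^'] --> d.
  apply/cvgrPdist_le => e e0; have [del del0 hdel] := H e e0.
  apply/nbhs_ballP; exists del => //= h; rewrite /ball /= sub0r normrN => hd h0.
  rewrite [h *: 1]mulr1 /GRing.scale /= -(ler_pM2r (x := `|h|)) ?normr_gt0 //.
  rewrite -normrM mulrBl mulrAC mulVf // mul1r.
  have := hdel h hd; rewrite -normrN (addrC x h).
  by apply: le_trans; rewrite le_eqVlt; apply/orP; left; apply/eqP;
    congr (`|_|); ring.
apply: DeriveDef; first by apply/cvg_ex; exists d.
by apply: cvg_lim => //; exact: Rhausdorff.
Qed.

End numfield_derivative.

Section complex_plane.
Context {R : realType}.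
Local Notation C := (R[i]^o).
Implicit Types (z w h d : C) (f g : C -> C).

(** The norm of [R[i]] takes its values in [R[i]]; a real-valued modulus gives access to the total
    order of [R] and to [lra]. *)
Definition modulus (z : C) : R := ComplexField.Normc.normc z.

Lemma normr_modulus z : `|z| = ((modulus z)%:C)%C.
Proof. by []. Qed.

Lemma sqr_modulus z : modulus z ^+ 2 = complex.Re z ^+ 2 + complex.Im z ^+ 2.
Proof.
by case: z => a b; rewrite /modulus /= sqr_sqrtr // addr_ge0 // sqr_ge0.
Qed.

Lemma modulus_ge0 z : 0 <= modulus z.
Proof. by case: z => a b; exact: sqrtr_ge0. Qed.

Lemma modulusM z w : modulus (z * w) = modulus z * modulus w.
Proof. exact: ComplexField.Normc.normcM. Qed.

Lemma modulusV z : modulus z^-1 = (modulus z)^-1.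
Proof. exact: ComplexField.Normc.normcV. Qed.

Lemma modulusD z w : modulus (z + w) <= modulus z + modulus w.
Proof. by have := ler_normD z w; rewrite !normr_modulus -rmorphD lecR. Qed.

Lemma modulusN z : modulus (- z) = modulus z.
Proof. exact: (normcN z). Qed.

Lemma modulus0 : modulus 0 = 0.
Proof. exact: ComplexField.Normc.normc0. Qed.

Lemma modulus1 : modulus 1 = 1.
Proof. exact: ComplexField.Normc.normc1. Qed.

Lemma modulus_eq0 z : (modulus z == 0) = (z == 0).
Proof.
apply/eqP/eqP => [/ComplexField.Normc.eq0_normc //|->]; exact: modulus0.
Qed.

Lemma modulus_conj z : modulus (z^*%C) = modulus z.
Proof. by case: z => a b; rewrite /modulus /= sqrrN. Qed.

Lemma modulus_real (x : R) : modulus (x%:C%C) = `|x|.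
Proof. by rewrite /modulus /= expr0n /= addr0 sqrtr_sqr. Qed.

Lemma Re_le_modulus z : `|complex.Re z| <= modulus z.
Proof. by rewrite -lecR; exact: normc_ge_Re. Qed.

Lemma Im_le_modulus z : `|complex.Im z| <= modulus z.
Proof.
rewrite -(@ler_sqr R) ?nnegrE ?modulus_ge0 // real_normK ?num_real //.
by rewrite sqr_modulus lerDr sqr_ge0.
Qed.

Lemma modulus_le (a b : R) : modulus (a +i* b)%C <= `|a| + `|b|.
Proof.
rewrite -(@ler_sqr R) ?nnegrE ?modulus_ge0 ?addr_ge0 // sqr_modulus /=.
rewrite sqrrD !real_normK ?num_real // lerD2r lerDl.
by rewrite mulrn_wge0 // mulr_ge0.
Qed.

Lemma unit_diskE z : unit_disk R z = (modulus z < 1) :> Prop.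
Proof. by rewrite /unit_disk /= normr_modulus -(ltcR _ 1). Qed.

Lemma mulcJ z : z * z^*%C = ((modulus z ^+ 2)%:C)%C.
Proof. by rewrite -sqr_normc normr_modulus rmorphXn. Qed.

(** A positive element of [R[i]] is a positive real, so both tolerances of the expansion may be
    taken in [R]. *)
Lemma is_derive_modulusP f z d :
  is_derive z (1 : C) f d <-> forall e : R, 0 < e ->
  exists2 del : R, 0 < del & forall h, modulus h < del ->
    modulus (f (z + h) - (f z + d * h)) <= e * modulus h.
Proof.
have step := @nf_is_deriveP R[i] f z d; split.
  move=> fd e e0; have [] := step.1 fd (e%:C)%C; first by rewrite (ltcR 0).
  move=> del del0 H; exists (complex.Re del).
    by move: del0; rewrite ltcE => /andP[].
  move=> h hd; have := H h; rewrite !normr_modulus -rmorphM lecR; apply.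
  by move: del0; rewrite !ltcE /= => /andP[/eqP -> _]; rewrite eqxx.
move=> H; apply: step.2 => e; rewrite ltcE /= => /andP[/eqP e1 e0].
have [del del0 hdel] := H _ e0; exists (del%:C)%C; first by rewrite (ltcR 0).
move=> h; rewrite !normr_modulus ltcR => /hdel.
have -> : e = (complex.Re e)%:C%C by case: (e) e1 => /= ? ? ->.
by rewrite -rmorphM lecR.
Qed.

Lemma cvg_complex (T : Type) (F : set_system T) {FF : Filter F}
    (a b : T -> R) (a0 b0 : R) :
  a t @[t --> F] --> a0 -> b t @[t --> F] --> b0 ->
  ((a t +i* b t)%C : C) @[t --> F] --> ((a0 +i* b0)%C : C).
Proof.
move=> /cvgrPdist_le ha /cvgrPdist_le hb; apply/cvgrPdist_le => e.
rewrite ltcE /= => /andP[/eqP e1 e0].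
have e20 : 0 < complex.Re e / 2 by rewrite divr_gt0.
near=> t.
have -> : e = (complex.Re e)%:C%C by case: (e) e1 => /= ? ? ->.
rewrite normr_modulus lecR; apply: le_trans (modulus_le _ _) _.
rewrite [leRHS]splitr; apply: lerD.
  by near: t; exact: ha.
by near: t; exact: hb.
Unshelve. all: by end_near. Qed.

Lemma cvg_Re (T : Type) (F : set_system T) {FF : Filter F} (f : T -> C) (l : C) :
  f t @[t --> F] --> l -> complex.Re (f t) @[t --> F] --> complex.Re l.
Proof.
move=> /cvgrPdist_le H; apply/cvgrPdist_le => e e0.
have : 0 < (e%:C)%C :> C by rewrite (ltcR 0).
move=> /H; apply: filterS => t; rewrite normr_modulus lecR.
by apply: le_trans; rewrite -raddfB; exact: Re_le_modulus.
Qed.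

Lemma cvg_Im (T : Type) (F : set_system T) {FF : Filter F} (f : T -> C) (l : C) :
  f t @[t --> F] --> l -> complex.Im (f t) @[t --> F] --> complex.Im l.
Proof.
move=> /cvgrPdist_le H; apply/cvgrPdist_le => e e0.
have : 0 < (e%:C)%C :> C by rewrite (ltcR 0).
move=> /H; apply: filterS => t; rewrite normr_modulus lecR.
by apply: le_trans; rewrite -raddfB; exact: Im_le_modulus.
Qed.

Lemma cderive_comp f g z (df dg : C) :
  is_derive (g z) (1 : C) f df -> is_derive z (1 : C) g dg ->
  is_derive z (1 : C) (f \o g) (df * dg).
Proof. exact: (@nf_is_derive_comp R[i]). Qed.

Lemma cderiveV f z (df : C) : f z != 0 -> is_derive z (1 : C) f df ->
  is_derive z (1 : C) (fun y => (f y)^-1) (- df / f z ^+ 2).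
Proof. exact: (@nf_is_deriveV R[i]). Qed.

Lemma cderiveM f g z (df dg : C) :
  is_derive z (1 : C) f df -> is_derive z (1 : C) g dg ->
  is_derive z (1 : C) (fun y => f y * g y) (f z * dg + g z * df).
Proof. exact: (@is_deriveM R[i]). Qed.

Lemma cderiveD f g z (df dg : C) :
  is_derive z (1 : C) f df -> is_derive z (1 : C) g dg ->
  is_derive z (1 : C) (fun y => f y + g y) (df + dg).
Proof. exact: (@is_deriveD R[i]). Qed.

Lemma cderive_cst z (c : C) : is_derive z (1 : C) (fun=> c) 0.
Proof. exact: (@is_derive_cst R[i]). Qed.

Lemma cderive_id z : is_derive z (1 : C) (fun y => y) 1.
Proof. exact: (@is_derive_id R[i]). Qed.

Lemma cderive_continuous f z (df : C) :
  is_derive z (1 : C) f df -> {for z, continuous f}.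
Proof.
move=> [D _]; apply: differentiable_continuous.
exact: ((@derivable1_diffP R[i] _ f z).1 D).
Qed.

End complex_plane.

(** * The Schwarz lemma and disk automorphisms *)

Section complex_exponential.
Context {R : realType}.
Local Notation C := (R[i]^o).
Implicit Types (z w : C) (x y : R).

Definition cexp (w : C) : C :=
  (expR (complex.Re w) * cos (complex.Im w)
   +i* (expR (complex.Re w) * sin (complex.Im w)))%C.

Lemma cexpD z w : cexp (z + w) = cexp z * cexp w.
Proof.
case: z => a b; case: w => c d; rewrite /cexp /= expRD cosD sinD.
by apply/eqP; rewrite eq_complex /=; apply/andP; split; apply/eqP; ring.
Qed.

Lemma modulus_cexp w : modulus (cexp w) = expR (complex.Re w).
Proof.
apply/eqP; rewrite -(@eqrXn2 R 2) ?modulus_ge0 ?expR_ge0 // sqr_modulus /=.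
by rewrite !exprMn -mulrDr cos2Dsin2 mulr1.
Qed.

Lemma is_derive_cexp0 : is_derive (0 : C) (1 : C) cexp 1.
Proof.
apply/is_derive_modulusP => e e0.
(* With m the modulus of the increment, the errors below add up to 9 k m, so 12 k <= e leaves room.
   The bound k <= 1 gives |expR x - 1| <= 2 m, and m < k makes the product (expR x - 1) y at most 2
   m k. *)
have [k [k0 k1 ke]] : exists k, [/\ 0 < k, k <= 1 & 12 * k <= e].
  exists (Num.min (e / 12) 1).
  split; first by rewrite lt_min ltr01 divr_gt0.
    by rewrite ge_min lexx orbT.
  by rewrite mulrC -ler_pdivlMr // ge_min lexx.
have [d1 d10 H1] := (@nf_is_deriveP R expR 0 1).1
  (is_derive_eq (is_derive_expR 0) (@expR0 R)) k k0.
have [d2 d20 H2] := (@nf_is_deriveP R cos 0 0).1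
  (is_derive_eq (is_derive_cos 0) (etrans (congr1 _ (@sin0 R)) (oppr0 _))) k k0.
have [d3 d30 H3] := (@nf_is_deriveP R sin 0 1).1
  (is_derive_eq (is_derive_sin 0) (@cos0 R)) k k0.
exists (Num.min (Num.min d1 d2) (Num.min d3 k)).
  by rewrite !lt_min d10 d20 d30 k0.
move=> [x y]; rewrite !lt_min => /andP[/andP[hd1 hd2] /andP[hd3 hd4]].
set m := modulus _ in hd1 hd2 hd3 hd4 *.
have xm : `|x| <= m by exact: (Re_le_modulus (x +i* y)%C).
have ym : `|y| <= m by exact: (Im_le_modulus (x +i* y)%C).
have := H1 x (le_lt_trans xm hd1); have := H2 y (le_lt_trans ym hd2).
have := H3 y (le_lt_trans ym hd3).
rewrite !add0r !expR0 sin0 cos0 !mul1r !mul0r !add0r addr0.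
have m0 : 0 <= m by exact: modulus_ge0.
have kym : k * `|y| <= k * m by rewrite ler_pM2l.
have kxm : k * `|x| <= k * m by rewrite ler_pM2l.
have km1 : k * m <= m by rewrite -[leRHS]mul1r ler_wpM2r.
move=> /le_trans /(_ kym) s3 /le_trans /(_ kym) s2 /le_trans /(_ kxm) s1.
have ex : `|expR x - 1| <= 2 * m.
  have -> : expR x - 1 = (expR x - (1 + x)) + x by ring.
  by have := ler_normD (expR x - (1 + x)) x; lra.
have ex3 : `|expR x| <= 3.
  have -> : expR x = (expR x - 1) + 1 by ring.
  by have := ler_normD (expR x - 1) 1; rewrite normr1; lra.
have -> : cexp (x +i* y)%C - (cexp 0 + (x +i* y)%C) =
    ((expR x * (cos y - 1) + (expR x - (1 + x)))
     +i* (expR x * (sin y - y) + (expR x - 1) * y))%C.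
  apply/eqP; rewrite eq_complex /cexp /= expR0 cos0 sin0.
  by apply/andP; split; apply/eqP; ring.
apply: le_trans (modulus_le _ _) _.
have := ler_normD (expR x * (cos y - 1)) (expR x - (1 + x)).
have := ler_normD (expR x * (sin y - y)) ((expR x - 1) * y).
rewrite !normrM.
have : `|expR x| * `|cos y - 1| <= 3 * (k * m) by apply: ler_pM.
have : `|expR x| * `|sin y - y| <= 3 * (k * m) by apply: ler_pM.
have : `|expR x - 1| * `|y| <= 2 * m * k.
  apply: ler_pM => //; exact: le_trans ym (ltW hd4).
have km0 : 0 <= k * m by rewrite mulr_ge0 // ltW.
have : 12 * k * m <= e * m by rewrite ler_wpM2r.
lra.
Qed.

(** The addition formula writes [cexp v] as [cexp w * cexp (v - w)], which transports the derivative
    at 0 to [w]. *)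
Lemma is_derive_cexp w : is_derive w (1 : C) cexp (cexp w).
Proof.
have <- : (fun v => cexp w * cexp v) \o (fun v => v + (- w)) = cexp.
  by apply/funext => v; rewrite /= -cexpD addrC subrK.
have -> : ((fun v => cexp w * cexp v) \o (fun v => v + (- w))) w
    = cexp w * 1 * (1 + 0).
  by rewrite addr0 !mulr1 /= -cexpD addrC subrK.
have dadd := cderiveD (cderive_id w) (cderive_cst w (- w)).
apply: cderive_comp dadd.
rewrite subrr; have -> : cexp w * 1 = cexp w * 1 + cexp 0 * 0.
  by rewrite mulr0 addr0.
exact: (cderiveM (cderive_cst 0 (cexp w)) is_derive_cexp0).
Qed.

Lemma cexp_periodic w : cexp (w + (0 +i* (pi *+ 2))%C) = cexp w.
Proof.
case: w => x y; rewrite /cexp /= addr0.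
by rewrite (cosD2pi y) (sinD2pi y).
Qed.

End complex_exponential.

(** * Means of a periodic holomorphic function over vertical segments *)

Section mean_value.
Context {R : realType}.
Local Notation C := (R[i]^o).
Notation mu := (@lebesgue_measure R).

(* The mean of [complex.Re h] over vertical segments of length a period: the
   form [Im h dx + Re h dy] is closed, and the contributions of the horizontal
   sides of the rectangle cancel. *)
Lemma mean_value (h dh : C -> C) (T s0 s1 : R) :
  (forall w : C, complex.Re w < 0 -> is_derive w (1 : C) h (dh w)) ->
  0 <= T -> (forall w, h (w + (0 +i* T)%C) = h w) -> s0 <= s1 -> s1 < 0 ->
  let U s y := complex.Re (h (Num.min s s1 +i* y)%C) in
  (forall s, continuous (U s)) /\
  \int[mu]_(y in `[0, T]) U s0 y = \int[mu]_(y in `[0, T]) U s1 y.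
Proof.
move=> hh T0 hT s01 s10 U.
(* Truncating the abscissa at s1 < 0 keeps all points in the half plane where [h] is differentiable,
   so [U] and [V] are continuous on the whole line, as [goursat] requires; on [s0, s1] nothing
   changes. *)
pose V s y := complex.Im (h (Num.min s s1 +i* y)%C).
have mins s : Num.min s s1 < 0 by rewrite gt_min s10 orbT.
have ch s y : {for ((Num.min s s1 +i* y)%C : C), continuous h}.
  by apply: cderive_continuous; apply: hh => /=.
have cU s : continuous (U s).
  move=> y; apply: cvg_Re.
  have cg : ((Num.min s s1 +i* t)%C : C) @[t --> y] -->
      ((Num.min s s1 +i* y)%C : C).
    by apply: cvg_complex; [exact: cvg_cst|exact: cvg_id].
  exact: (cvg_comp _ _ cg (ch s y)).
split => //.
have cV y : continuous (V ^~ y).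
  move=> s; apply: cvg_Im.
  have cg : ((Num.min t s1 +i* y)%C : C) @[t --> s] -->
      ((Num.min s s1 +i* y)%C : C).
    apply: cvg_complex; last exact: cvg_cst.
    by apply: (@continuous_min _ _ id (cst s1));
      [exact: cvg_id|exact: cvg_cst].
  exact: (cvg_comp _ _ cg (ch s y)).
have := @goursat R V U cV cU s0 s1 0 T s01 T0.
move=> /(_ _)/wrap[]; last first.
  rewrite /boundary_integral.
  have -> : (fun x => V x T) = (fun x => V x 0).
    apply/funext => x; rewrite /V -[in RHS]hT; congr (complex.Im (h _)).
    by apply/eqP; rewrite eq_complex /= addr0 add0r !eqxx.
  by rewrite subrr add0r => /eqP; rewrite subr_eq0 => /eqP.
move=> p q /andP[_ ps1] _.
have pp : Num.min p s1 = p by apply/min_idPl.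
pose d := dh (p +i* q)%C.
have /is_derive_modulusP D : is_derive ((p +i* q)%C : C) (1 : C) h d.
  by apply: hh => /=; rewrite -pp.
(* Cauchy-Riemann: the y-slope of Im h and the x-slope of Re h are both Re d. Taking [del / 3] below
   makes the modulus of the increment, at most |x - p| + |y - q|, strictly less than [del]. *)
exists (complex.Im d), (complex.Re d), (- complex.Im d) => e e0.
have [del del0 H] := D e e0; exists (del / 3); first by rewrite divr_gt0.
move=> x y /andP[_ xs1] _ hx hy.
have xx : Num.min x s1 = x by apply/min_idPl.
have mle := modulus_le (x - p) (y - q).
have := H ((x - p) +i* (y - q))%C; move=> /(_ _)/wrap[].
  by apply: le_lt_trans mle _; lra.
set E := h _ - _ => hE.
have {}hE : modulus E <= e * (`|x - p| + `|y - q|).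
  by apply: le_trans hE _; rewrite ler_pM2l.
have hxy : ((p +i* q) + ((x - p) +i* (y - q)) = x +i* y)%C.
  by apply/eqP; rewrite eq_complex /= ![_ + (_ - _)]addrC !subrK !eqxx.
rewrite /E hxy in hE.
split.
- rewrite /V pp xx; apply: le_trans hE; apply: le_trans (Im_le_modulus _).
  rewrite le_eqVlt; apply/orP; left; apply/eqP; congr (`|_|).
  rewrite !raddfB !raddfD /=; case: (d) => d1 d2 /=; ring.
- rewrite /U pp xx; apply: le_trans hE; apply: le_trans (Re_le_modulus _).
  rewrite le_eqVlt; apply/orP; left; apply/eqP; congr (`|_|).
  rewrite !raddfB !raddfD /=; case: (d) => d1 d2 /=; ring.
Qed.

End mean_value.

(** * The Schwarz bound on the derivative at the centre *)

Section schwarz.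
Context {R : realType}.
Local Notation C := (R[i]^o).
Notation mu := (@lebesgue_measure R).
Implicit Types (F dF : C -> C) (z w a : C).

Lemma schwarz_derivative F dF :
  (forall z, modulus z < 1 -> is_derive z (1 : C) F (dF z)) ->
  (forall z, modulus z < 1 -> modulus (F z) <= 1) ->
  F 0 = 0 -> modulus (dF 0) <= 1.
Proof.
move=> hF F1 F0; rewrite leNgt; apply/negP.
set d := dF 0; have [m mE] : exists m, modulus d = m by exists (modulus d).
rewrite mE => m1; have m0 : 0 < m by exact: lt_trans m1.
have lt1 (w : C) : complex.Re w < 0 -> modulus (cexp w) < 1.
  by move=> w0; rewrite modulus_cexp expR_lt1.
have [T T0 cexpT] : exists2 T : R, 0 < T &
    forall w : C, cexp (w + (0 +i* T)%C) = cexp w.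
  by exists (pi *+ 2); [rewrite mulrn_wgt0 // pi_gt0|exact: cexp_periodic].
(* [h w = conj (F' 0) * F (e^w) / e^w] tends to [|F' 0|^2] as [Re w] tends to
   -oo and is bounded by [|F' 0| e^(- Re w)]. *)
pose h (w : C) : C := (d^*)%C * (F (cexp w) * cexp (- w)).
have [dh hh] : exists dh : C -> C,
    forall w : C, complex.Re w < 0 -> is_derive w (1 : C) h (dh w).
  have H (w : C) : exists e, complex.Re w < 0 -> is_derive w (1 : C) h e;
    last by have [dh Hdh] := choice H; exists dh.
  have [w0|] := boolP (complex.Re w < 0); last by exists 0.
  eexists=> _; apply: (cderiveM (cderive_cst w _)).
  apply: cderiveM.
    exact: (cderive_comp (hF _ (lt1 _ w0)) (is_derive_cexp w)).
  exact: (cderive_comp (is_derive_cexp _)).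
have hper (w : C) : h (w + (0 +i* T)%C) = h w.
  rewrite /h cexpT; congr (_ * (_ * _)).
  by rewrite -[LHS]cexpT opprD subrK.
(* If m > 1 there is room for 1 < r < m - e. Here r is 1/|z| on the circle Re w = s1, so the mean is
   at most m r there, while on a small circle Re w = s0 it is at least m (m - e); the two means
   agree. *)
have [r [r0 r1 rm]] : exists r : R, [/\ 0 < r, 1 < r & r < m].
  by exists ((1 + m) / 2); split; lra.
have [s1 s10 es1] : exists2 s1 : R, s1 < 0 & expR (- s1) = r.
  exists (- ln r); first by rewrite oppr_lt0 ln_gt0.
  by rewrite opprK lnK // posrE.
have [e e0 er] : exists2 e : R, 0 < e & r < m - e.
  by exists ((m - r) / 2); lra.
have h0 : modulus (0 : C) < 1 by rewrite modulus0.
have /is_derive_modulusP /(_ e e0)[del del0 Hdel] := hF 0 h0.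
have [s0 s01 es0] : exists2 s0 : R, s0 <= s1 & expR s0 < del.
  exists (Num.min s1 (ln (del / 2))); first by rewrite ge_min lexx.
  apply: (@le_lt_trans _ _ (expR (ln (del / 2)))).
    by rewrite ler_expR ge_min lexx orbT.
  by rewrite lnK ?posrE; lra.
pose U s y := complex.Re (h (Num.min s s1 +i* y)%C).
have [cU eqI] : (forall s, continuous (U s)) /\
    \int[mu]_(y in `[0, T]) U s0 y = \int[mu]_(y in `[0, T]) U s1 y.
  exact: mean_value hh (ltW T0) hper s01 s10.
have Us1 y : U s1 y <= m * r.
  apply: le_trans (ler_norm _) _; apply: le_trans (Re_le_modulus _) _.
  rewrite minxx /h !modulusM modulus_conj mE (ler_pM2l m0).
  have Fle := F1 _ (lt1 (s1 +i* y)%C s10).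
  rewrite [modulus (cexp (- _))]modulus_cexp [expR _]es1.
  exact: ler_piMl (ltW r0) Fle.
have Us0 y : m * (m - e) <= U s0 y.
  rewrite /U (min_idPl s01); set w := (s0 +i* y)%C.
  have w1 : modulus (cexp w) < del by rewrite modulus_cexp; exact: es0.
  have := Hdel (cexp w) w1; rewrite add0r F0 add0r -/d.
  set E := F _ - _ => hE.
  have -> : h w = ((m ^+ 2)%:C)%C + (d^*)%C * (E * cexp (- w)).
    rewrite /h /E mulrBl -[d * _ * _]mulrA -cexpD subrr.
    rewrite -mE -[(modulus d ^+ 2)%:C%C]mulcJ.
    have -> : cexp 0 = 1 :> C by rewrite /cexp /= expR0 cos0 sin0 mulr1 mulr0.
    by rewrite mulr1 mulrBr [d * _]mulrC addrC subrK.
  have hm : modulus ((d^*)%C * (E * cexp (- w))) <= m * e.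
    rewrite !modulusM modulus_conj mE (ler_pM2l m0).
    move: hE; rewrite !modulus_cexp raddfN expRN => hE.
    by rewrite (ler_pdivrMr _ _ (expR_gt0 _)).
  have := le_trans (Re_le_modulus _) hm.
  move: ((d^*)%C * _) => [x x'] /=; rewrite ler_norml => /andP[mex _].
  by rewrite mulrBr -expr2 lerD2l.
have I1 := Rintegral_cc_le (cU s1) (ltW T0) (fun y _ => Us1 y).
have I0 := Rintegral_cc_ge (cU s0) (ltW T0) (fun y _ => Us0 y).
move: I0; rewrite eqI => /le_trans /(_ I1).
by rewrite subr0 (ler_pM2r T0) (ler_pM2l m0) leNgt er.
Qed.

End schwarz.

(** * Blaschke factors and the Schwarz-Pick inequality *)

Section moebius.
Context {R : realType}.
Local Notation C := (R[i]^o).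
Implicit Types (F dF f : C -> C) (z w a : C).

Definition blaschke (a z : C) : C := (z - a) / (1 - (a^*)%C * z).

(** The bound on [z] is not strict, so that the lemma also serves for boundary values on the
    circle. *)
Lemma blaschke_den_neq0 a z :
  modulus a < 1 -> modulus z <= 1 -> 1 - (a^*)%C * z != 0.
Proof.
move=> a1 z1; apply/eqP => /eqP; rewrite subr_eq0 => /eqP e.
have : modulus ((a^*)%C * z) < 1.
  rewrite modulusM modulus_conj; apply: le_lt_trans a1.
  by rewrite ler_piMr // modulus_ge0.
by rewrite -e modulus1 ltxx.
Qed.

(** Divided by the squared modulus of the denominator, this exhibits 1 - |blaschke a z|^2 as a
    positive multiple of 1 - |z|^2. *)
Lemma blaschke_modulus_id a z :
  modulus (1 - (a^*)%C * z) ^+ 2 - modulus (z - a) ^+ 2 =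
  (1 - modulus a ^+ 2) * (1 - modulus z ^+ 2).
Proof.
by rewrite !sqr_modulus; case: a => a1 a2; case: z => z1 z2 /=; ring.
Qed.

Lemma sqr_modulus_lt1 z : (modulus z ^+ 2 < 1) = (modulus z < 1).
Proof. by rewrite expr_lt1 // modulus_ge0. Qed.

Lemma blaschke_disk a z : modulus a < 1 -> modulus z < 1 ->
  modulus (blaschke a z) < 1.
Proof.
move=> a1 z1; have d0 := blaschke_den_neq0 a1 (ltW z1).
have m0 : 0 < modulus (1 - (a^*)%C * z).
  by rewrite lt_def modulus_eq0 d0 modulus_ge0.
rewrite /blaschke modulusM modulusV ltr_pdivrMr // mul1r.
rewrite -(@ltr_sqr R) ?nnegrE ?modulus_ge0 // -subr_gt0 blaschke_modulus_id.
by rewrite mulr_gt0 // subr_gt0 sqr_modulus_lt1.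
Qed.

Lemma blaschkeK a z : modulus a < 1 -> modulus z < 1 ->
  blaschke (- a) (blaschke a z) = z.
Proof.
move=> a1 z1; have d0 := blaschke_den_neq0 a1 (ltW z1).
have na1 : modulus (- a) < 1 by rewrite modulusN.
have := blaschke_den_neq0 na1 (ltW (blaschke_disk a1 z1)).
rewrite /blaschke rmorphN /= => d1.
have d2 : 1 - (a^*)%C * a != 0 by apply: blaschke_den_neq0 => //; exact: ltW.
move: d0 d1 d2; set b := (a^*)%C => d0 d1 d2.
have e1 : (z - a) / (1 - b * z) - (- a) = z * (1 - b * a) / (1 - b * z).
  by field.
have e2 : 1 - (- b) * ((z - a) / (1 - b * z)) = (1 - b * a) / (1 - b * z).
  by field.
by rewrite e1 e2; field; rewrite d0 d2.
Qed.

Lemma is_derive_blaschke a z : modulus a < 1 -> modulus z <= 1 ->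
  is_derive z (1 : C) (blaschke a)
    ((1 - modulus a ^+ 2)%:C%C / (1 - (a^*)%C * z) ^+ 2).
Proof.
move=> a1 z1; have d0 := blaschke_den_neq0 a1 z1.
have dn := cderiveD (cderive_id z) (cderive_cst z (- a)).
have dm := cderiveM (cderive_cst z (- (a^*)%C)) (cderive_id z).
have dd := cderiveD (cderive_cst z 1) dm.
have f0 : 1 + - (a^*)%C * z != 0 by rewrite mulNr.
have dv := cderiveV (f := fun y => 1 + - (a^*)%C * y) f0 dd.
have := cderiveM dn dv.
have -> : (fun y => (y + - a) * (1 + - (a^*)%C * y)^-1) = blaschke a.
  by apply/funext => y; rewrite /blaschke mulNr.
congr is_derive; rewrite rmorphB /= -mulcJ.
by move: d0 f0; set b := (a^*)%C => d0 f0; field.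
Qed.

Lemma schwarz_pick F dF :
  (forall z, modulus z < 1 -> is_derive z (1 : C) F (dF z)) ->
  (forall z, modulus z < 1 -> modulus (F z) < 1) ->
  forall w, modulus w < 1 ->
  modulus (dF w) * (1 - modulus w ^+ 2) <= 1 - modulus (F w) ^+ 2.
Proof.
move=> hF F1 w w1; have nw1 : modulus (- w) < 1 by rewrite modulusN.
have Fw1 := F1 w w1.
(* The map g fixes 0: it goes from 0 to w, then to F w, then back to 0. Its derivative at 0 is F'(w)
   times (1 - |w|^2) / (1 - |F w|^2). *)
pose g := blaschke (F w) \o (F \o blaschke (- w)).
pose dg (z : C) : C :=
  (1 - modulus (F w) ^+ 2)%:C%C
    / (1 - ((F w)^*)%C * F (blaschke (- w) z)) ^+ 2 *
  (dF (blaschke (- w) z) *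
   ((1 - modulus (- w) ^+ 2)%:C%C / (1 - ((- w)^*)%C * z) ^+ 2)).
have b0 : blaschke (- w) 0 = w.
  by rewrite /blaschke add0r opprK mulr0 subr0 divr1.
have := @schwarz_derivative R g dg; move=> /(_ _ _ _)/wrap[].
- move=> z z1; have bz := blaschke_disk nw1 z1.
  apply: cderive_comp; first by apply: is_derive_blaschke => //; exact/ltW/F1.
  apply: cderive_comp; first exact: hF.
  exact: (is_derive_blaschke nw1 (ltW z1)).
- by move=> z z1; apply/ltW/blaschke_disk => //; apply/F1/blaschke_disk.
- by rewrite /g /= b0 /blaschke subrr mul0r.
rewrite /dg b0 mulr0 subr0 expr1n divr1 mulrC [(F w)^*%C * _]mulrC mulcJ.
set k := 1 - modulus (F w) ^+ 2.
have k0 : 0 < k by rewrite subr_gt0 sqr_modulus_lt1.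
have -> : (1 : C) - ((modulus (F w) ^+ 2)%:C)%C = k%:C%C by rewrite rmorphB.
have kC : k%:C%C != 0 :> C by rewrite -modulus_eq0 modulus_real gtr0_norm ?gt_eqF.
have -> : k%:C%C / k%:C%C ^+ 2 = (k%:C%C)^-1 :> C by field.
rewrite !modulusM modulusV !modulus_real modulusN (gtr0_norm k0).
rewrite ger0_norm; last by rewrite subr_ge0 ltW // sqr_modulus_lt1.
by rewrite ler_pdivrMr // mul1r.
Qed.

(** Passage from complex to real derivatives. The factor [c] selects the quantity observed: 1 and 'i
    for the real and imaginary parts, a rotation when a given value must become real. With [z0]
    purely imaginary and [F] a function of the exponential, the ray runs along the circle. *)
Lemma is_derive_ray F (d z0 c : C) (t : R) :
  is_derive ((t%:C)%C * z0 : C) (1 : C) F d ->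
  is_derive t (1 : R) (fun x : R => complex.Re (c * F ((x%:C)%C * z0)))
    (complex.Re (c * (d * z0))).
Proof.
move=> /is_derive_modulusP H; apply/(@nf_is_deriveP R) => e e0.
(* Both increments by 1 keep [k] positive while it still dominates |c| |z0|. *)
pose k := (modulus c + 1) * (modulus z0 + 1).
have c0 := modulus_ge0 c; have m0 := modulus_ge0 z0.
have k0 : 0 < k by rewrite mulr_gt0 // ltr_wpDl.
have [del del0 hdel] := H (e / k) (divr_gt0 e0 k0).
exists (del / (modulus z0 + 1)); first by rewrite divr_gt0 // ltr_wpDl.
move=> x; rewrite ltr_pdivlMr ?ltr_wpDl // => hx.
have := hdel ((x%:C)%C * z0); rewrite modulusM modulus_real.
move=> /(_ _)/wrap[].
  by apply: le_lt_trans hx; rewrite ler_wpM2l // lerDl.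
rewrite -mulrDl -rmorphD; set E := F _ - _ => hE.
have -> : complex.Re (c * F (((t + x)%:C)%C * z0)) -
  (complex.Re (c * F ((t%:C)%C * z0)) + complex.Re (c * (d * z0)) * x) =
  complex.Re (c * E).
  rewrite /E; case: (F (((t + x)%:C)%C * z0)) => u1 u2.
  case: (F ((t%:C)%C * z0)) => v1 v2; case: (c) => c1 c2; case: (d) => d1 d2.
  by case: (z0) => x1 x2 /=; ring.
apply: le_trans (Re_le_modulus _) _; rewrite modulusM.
apply: le_trans (ler_wpM2l c0 hE) _.
have -> : modulus c * (e / k * (`|x| * modulus z0)) =
  (e * `|x|) * ((modulus c * modulus z0) / k) by field; rewrite gt_eqF.
rewrite -[leRHS]mulr1 ler_wpM2l //; first by rewrite mulr_ge0 // ltW.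
by rewrite ler_pdivrMr // mul1r /k; apply: ler_pM => //; rewrite lerDl.
Qed.

End moebius.

(** * The Schwarz lemma and the form of disk automorphisms *)

Section rigidity.
Context {R : realType}.
Local Notation C := (R[i]^o).
Implicit Types (F G dF f : C -> C) (z w a : C).

Lemma schwarz_lemma F dF :
  (forall z, modulus z < 1 -> is_derive z (1 : C) F (dF z)) ->
  (forall z, modulus z < 1 -> modulus (F z) < 1) ->
  F 0 = 0 -> forall z, modulus z < 1 -> modulus (F z) <= modulus z.
Proof.
move=> hF F1 F0 z z1; set M := modulus (F z); set s := modulus z.
have s0 : 0 <= s by exact: modulus_ge0.
have [->|M0] := eqVneq M 0; first exact: modulus_ge0.
have Mgt0 : 0 < M by rewrite lt_def M0 modulus_ge0.
(* The rotation by [c] makes F z a nonnegative real; the real part m then satisfies m 1 = |F z| and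
   |m t| <= |F (t z)|. *)
have [c mc cF] : exists2 c : C, modulus c = 1 & c * F z = M%:C%C.
  exists (((F z)^*)%C / M%:C%C).
    by rewrite modulusM modulusV modulus_conj modulus_real gtr0_norm // mulfV.
  rewrite mulrAC [_ * F z]mulrC mulcJ -/M expr2 rmorphM /= mulfK //.
  by rewrite -modulus_eq0 modulus_real gtr0_norm.
pose m (t : R) := complex.Re (c * F (t%:C%C * z)).
pose dm (t : R) := complex.Re (c * (dF (t%:C%C * z) * z)).
have inD (t : R) : 0 <= t <= 1 -> modulus (t%:C%C * z) < 1.
  move=> /andP[t0 t1]; rewrite modulusM modulus_real ger0_norm //.
  by apply: le_lt_trans z1; rewrite ler_piMl.
have hm (t : R) : 0 <= t <= 1 -> is_derive t (1 : R) m (dm t).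
  by move=> t01; exact: (is_derive_ray c (hF _ (inD t t01))).
have mF t : `|m t| <= modulus (F (t%:C%C * z)).
  by apply: le_trans (Re_le_modulus _) _; rewrite modulusM mc mul1r.
have m1 t : 0 <= t <= 1 -> -1 < m t < 1.
  by move=> /inD /F1 /(le_lt_trans (mF t)); rewrite ltr_norml.
have ts1 t : 0 <= t <= 1 -> 0 <= t * s < 1.
  move=> /andP[t0 t1]; rewrite mulr_ge0 //=; apply: le_lt_trans z1.
  by rewrite ler_piMl.
(* Schwarz-Pick in terms of [m] alone: taking real parts only lowers the derivative on the left and,
   since |m| <= |F|, only raises the right-hand side. *)
have dmle t : 0 <= t <= 1 -> dm t * (1 - (t * s) ^+ 2) <= s * (1 - m t ^+ 2).
  move=> t01; have /andP[ts0 tsl] := ts1 t t01.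
  have dm1 : dm t <= modulus (dF (t%:C%C * z)) * s.
    apply: le_trans (ler_norm _) _; apply: le_trans (Re_le_modulus _) _.
    by rewrite !modulusM mc mul1r.
  have := schwarz_pick hF F1 (inD t t01).
  have -> : modulus (t%:C%C * z) = t * s.
    by rewrite modulusM modulus_real ger0_norm //; case/andP: t01.
  have q0 : 0 <= 1 - (t * s) ^+ 2 by rewrite subr_ge0 expr_le1 // ltW.
  move=> SP; apply: le_trans (ler_wpM2r q0 dm1) _.
  rewrite mulrAC mulrC ler_wpM2l //; apply: le_trans SP _.
  rewrite lerD2l lerN2 -[leLHS]real_normK ?num_real //.
  by rewrite ler_sqr ?nnegrE ?modulus_ge0.
(* [ln Q = 2 (artanh m - artanh (t |z|))] *)
pose Q t := (1 + m t) * (1 - t * s) / ((1 - m t) * (1 + t * s)).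
pose dQ t := 2 * (dm t * (1 - (t * s) ^+ 2) - s * (1 - m t ^+ 2))
  / ((1 - m t) * (1 + t * s)) ^+ 2.
have den0 t : 0 <= t <= 1 -> 0 < (1 - m t) * (1 + t * s).
  move=> t01; have /andP[ts0 tsl] := ts1 t t01; have /andP[ml mr] := m1 t t01.
  by rewrite mulr_gt0 //; lra.
have hQ (t : R) : 0 <= t <= 1 -> is_derive t (1 : R) Q (dQ t).
  move=> t01; have d0 := den0 t t01; have hmt := hm t t01.
  have dA : is_derive t (1 : R) (fun t => (1 + m t) * (1 - t * s))
      ((1 + m t) * (- s) + (1 - t * s) * dm t).
    by apply: is_derive_eq; rewrite /GRing.scale /=; ring.
  have dB : is_derive t (1 : R) (fun t => (1 - m t) * (1 + t * s))
      ((1 - m t) * s + (1 + t * s) * (- dm t)).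
    by apply: is_derive_eq; rewrite /GRing.scale /=; ring.
  have d0' : (1 - m t) * (1 + t * s) != 0 by rewrite gt_eqF.
  have dV := nf_is_deriveV (f := fun t => (1 - m t) * (1 + t * s)) d0' dB.
  apply: (is_derive_eq (is_deriveM dA dV)).
  rewrite /dQ /GRing.scale /=; field.
  by move: d0'; rewrite mulf_eq0 negb_or => /andP[-> ->].
have hQ' (t : R) : t \in `]0, 1[ -> is_derive t (1 : R) Q (dQ t).
  by rewrite in_itv /= => /andP[? ?]; apply: hQ; rewrite !ltW.
have cQ : {within `[0, 1], continuous Q}.
  apply: derivable_within_continuous => t; rewrite in_itv /= => t01.
  by have [] := hQ t t01.
have [t t01 eQ] := MVT ltr01 hQ' cQ.
have {}t01 : 0 <= t <= 1 by move: t01; rewrite in_itv /= => /andP[? ?]; rewrite !ltW.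
have dQ0 : dQ t <= 0.
  rewrite /dQ ler_pdivrMr; last by rewrite exprn_gt0 // den0.
  by rewrite mul0r; have := dmle t t01; lra.
have Q0 : Q 0 = 1.
  rewrite /Q /m mul0r F0 mulr0 /= !mul0r !subr0 !addr0; by field.
have mM : m 1 = M.
  by rewrite /m mul1r cF.
(* At t = 1 the inequality reads (1 + M) (1 - s) <= (1 - M) (1 + s), which is M <= s. *)
have : Q 1 <= 1 by rewrite -subr_le0 -{2}Q0 eQ subr0 mulr1.
have l11 : (0 : R) <= (1 : R) <= (1 : R) by apply/andP.
rewrite /Q ler_pdivrMr; last exact: den0.
by rewrite mM !mul1r; lra.
Qed.

(** The maximum principle at first order: if d were nonzero, an increment h with d h a positive
    multiple of f z would push the modulus above 1. *)
Lemma derive_eq0_modulus_max f z d (del : R) : 0 < del ->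
  is_derive z (1 : C) f d ->
  (forall h, modulus h < del -> modulus (f (z + h)) <= 1) ->
  modulus (f z) = 1 -> d = 0.
Proof.
move=> del0 /is_derive_modulusP D f1 fz; apply/eqP/negP => /negP d0.
have md : 0 < modulus d by rewrite lt_def modulus_eq0 d0 modulus_ge0.
have [del' del'0 H] := D (modulus d / 2) (divr_gt0 md (ltr0Sn _ 1)).
(* With d h = t f z the modulus of h is half of min(del, del'). The linear part has modulus 1 + t
   and, with tolerance |d| / 2, the remainder is at most t / 2. *)
pose t := Num.min del del' * modulus d / 2.
have mm0 : 0 < Num.min del del' by rewrite lt_min del0 del'0.
have t0 : 0 < t by rewrite /t divr_gt0 // mulr_gt0.
pose h : C := t%:C%C * f z / d.
have mh : modulus h = t / modulus d.
  by rewrite /h !modulusM modulusV fz mulr1 modulus_real gtr0_norm.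
have mht : modulus h < Num.min del del'.
  by rewrite mh ltr_pdivrMr // /t ltr_pdivrMr // ltr_pMr ?mulr_gt0 // ltr1n.
move: mht; rewrite lt_min => /andP[h1 h2].
have := H h h2; have := f1 h h1.
have -> : d * h = t%:C%C * f z by rewrite /h mulrC divfK.
set E := f (z + h) - _ => e1 e2.
have : modulus (f z + t%:C%C * f z) <= modulus (f (z + h)) + modulus E.
  have -> : f z + t%:C%C * f z = f (z + h) + (- E) by rewrite /E opprB [RHS]addrC subrK.
  by rewrite -[modulus E]modulusN modulusD.
have -> : f z + t%:C%C * f z = (1 + t)%:C%C * f z by rewrite rmorphD mulrDl mul1r.
rewrite modulusM modulus_real fz mulr1 gtr0_norm; last by lra.
move: e2; rewrite mh.
have -> : modulus d / 2 * (t / modulus d) = t / 2 by field; rewrite gt_eqF.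
lra.
Qed.

(** The quotient F(w) / w has modulus 1 off the origin, so its derivative vanishes there; it is
    constant on each ray and tends to F'(0) at the origin. All rays share this limit, so they need
    not be compared with one another. *)
Lemma holomorphic_isometry F dF :
  (forall z, modulus z < 1 -> is_derive z (1 : C) F (dF z)) ->
  F 0 = 0 -> (forall z, modulus z < 1 -> modulus (F z) = modulus z) ->
  forall z, modulus z < 1 -> F z = dF 0 * z.
Proof.
move=> hF F0 mF z z1.
have [->|z0] := eqVneq z 0; first by rewrite F0 mulr0.
have mz0 : 0 < modulus z by rewrite lt_def modulus_eq0 z0 modulus_ge0.
pose q (w : C) := F w * w^-1.
have hq w : modulus w < 1 -> w != 0 -> is_derive w (1 : C) q 0.
  move=> w1 w0.
  have dq := cderiveM (hF w w1) (cderiveV w0 (cderive_id w)).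
  have mw0 : 0 < modulus w by rewrite lt_def modulus_eq0 w0 modulus_ge0.
  (* Within this radius w + h stays in the disk and does not reach 0. *)
  pose del := Num.min (1 - modulus w) (modulus w).
  have del0 : 0 < del by rewrite lt_min subr_gt0 w1.
  have q1 v : modulus v < 1 -> v != 0 -> modulus (q v) = 1.
    by move=> v1 v0; rewrite modulusM modulusV mF // mulfV // modulus_eq0.
  have := derive_eq0_modulus_max del0 dq; move=> /(_ _ (q1 w w1 w0))/wrap[].
    move=> h; rewrite lt_min => /andP[h1 h2].
    rewrite -/(q (w + h)) q1 //; first by apply: le_lt_trans (modulusD _ _) _; lra.
    apply/eqP => /eqP; rewrite addr_eq0 => /eqP e.
    by move: h2; rewrite e modulusN ltxx.
  by move=> <-.
have qconst (c : C) (t : R) : 0 < t -> t < 1 ->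
    complex.Re (c * q (t%:C%C * z)) = complex.Re (c * q z).
  move=> t0 t1.
  pose r (t : R) := complex.Re (c * q (t%:C%C * z)).
  have hr (x : R) : t <= x <= 1 -> is_derive x (1 : R) r 0.
    move=> /andP[tx x1]; have x0 : 0 < x by exact: lt_le_trans tx.
    have := @is_derive_ray R q 0 z c x; rewrite mul0r mulr0; apply.
    apply: hq.
      rewrite modulusM modulus_real gtr0_norm //; apply: le_lt_trans z1.
      by rewrite ler_piMl // modulus_ge0.
    rewrite mulf_neq0 // -modulus_eq0 modulus_real gtr0_norm // gt_eqF //.
  have hr' (x : R) : x \in `]t, 1[ -> is_derive x (1 : R) r 0.
    by rewrite in_itv /= => /andP[? ?]; apply: hr; rewrite !ltW.
  have cr : {within `[t, 1], continuous r}.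
    apply: derivable_within_continuous => x; rewrite in_itv /= => x01.
    by have [] := hr x x01.
  have [_ _] := MVT t1 hr' cr.
  by rewrite mul0r /r mul1r => /eqP; rewrite subr_eq0 => /eqP.
have qray (t : R) : 0 < t -> t < 1 -> q (t%:C%C * z) = q z.
  move=> t0 t1; have h1 := qconst 1 t t0 t1; have h2 := qconst 'i%C t t0 t1.
  move: h1 h2; case: (q _) => a b; case: (q z) => a' b' /=.
  rewrite !mul1r !mul0r !subr0 !sub0r => -> /oppr_inj.
  by rewrite ?mul1r => ->.
have qd : q z = dF 0.
  apply/eqP; rewrite -subr_eq0 -modulus_eq0 eq_le modulus_ge0 andbT.
  apply/ler_addgt0Pr => e e0; rewrite add0r.
  have h0 : modulus (0 : C) < 1 by rewrite modulus0.
  have /is_derive_modulusP /(_ e e0)[del del0 H] := hF 0 h0.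
  pose t := Num.min (del / 2) (1 / 2).
  have [t0 t1 td] : [/\ 0 < t, t < 1 & t < del].
    by split; rewrite ?lt_min ?gt_min; lra.
  have tz0 : t%:C%C * z != 0 :> C.
    by rewrite mulf_neq0 // -modulus_eq0 modulus_real gtr0_norm // gt_eqF.
  have := H (t%:C%C * z); rewrite F0 !add0r => /(_ _)/wrap[].
    rewrite modulusM modulus_real gtr0_norm //; apply: le_lt_trans td.
    by rewrite ler_piMr // ltW.
  have -> : F (t%:C%C * z) - dF 0 * (t%:C%C * z) = (q z - dF 0) * (t%:C%C * z).
    by rewrite -(qray t t0 t1) /q [in RHS]mulrBl divfK.
  by rewrite modulusM ler_pM2r // lt_def modulus_eq0 tz0 modulus_ge0.
by rewrite -qd /q divfK.
Qed.

(** Here [a] is the zero of F. After composition with Blaschke factors, F and its inverse both fix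
    0, and the Schwarz lemma for the two of them forces equality of moduli. The relation is stated
    without division so that it passes to limits on the circle. *)
Theorem disk_automorphism_moebius F : disk_automorphism F ->
  exists a c : C, [/\ modulus a < 1, modulus c = 1 &
    forall z, modulus z < 1 -> F z * (1 - (a^*)%C * z) = c * (z - a)].
Proof.
move=> [G [hF hG FG GF]].
have deriv f : holomorphic_on (unit_disk R) f -> exists df : C -> C,
    forall z, modulus z < 1 -> is_derive z (1 : C) f (df z).
  move=> hf; exists (fun z => 'D_1 f z) => z z1.
  by apply: (@derivableP R[i]); apply: hf; rewrite unit_diskE.
have [dF hdF] := deriv F hF; have [dG hdG] := deriv G hG.
have F1 z : modulus z < 1 -> modulus (F z) < 1.
  by rewrite -!unit_diskE => /FG[].
have G1 z : modulus z < 1 -> modulus (G z) < 1.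
  by rewrite -!unit_diskE => /GF[].
have FK z : modulus z < 1 -> G (F z) = z by rewrite -unit_diskE => /FG[].
have GK z : modulus z < 1 -> F (G z) = z by rewrite -unit_diskE => /GF[].
have h0 : modulus (0 : C) < 1 by rewrite modulus0.
pose a := G 0; have a1 : modulus a < 1 by exact: G1.
have na1 : modulus (- a) < 1 by rewrite modulusN.
have bKN z : modulus z < 1 -> blaschke a (blaschke (- a) z) = z.
  by move=> z1; rewrite -{1}[a]opprK blaschkeK.
pose F2 := F \o blaschke (- a); pose G2 := blaschke a \o G.
have hF2 z : modulus z < 1 -> is_derive z (1 : C) F2 (dF (blaschke (- a) z) *
    ((1 - modulus (- a) ^+ 2)%:C%C / (1 - ((- a)^*)%C * z) ^+ 2)).
  move=> z1; apply: cderive_comp; first by apply: hdF; exact: blaschke_disk.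
  exact: (is_derive_blaschke na1 (ltW z1)).
have hG2 z : modulus z < 1 -> is_derive z (1 : C) G2
    ((1 - modulus a ^+ 2)%:C%C / (1 - (a^*)%C * G z) ^+ 2 * dG z).
  move=> z1; apply: cderive_comp; last exact: hdG.
  by apply: is_derive_blaschke => //; exact/ltW/G1.
have F21 z : modulus z < 1 -> modulus (F2 z) < 1.
  by move=> z1; apply/F1/blaschke_disk.
have G21 z : modulus z < 1 -> modulus (G2 z) < 1.
  by move=> z1; apply/blaschke_disk => //; exact: G1.
have F20 : F2 0 = 0.
  by rewrite /F2 /= /blaschke add0r opprK mulr0 subr0 divr1 GK.
have G20 : G2 0 = 0 by rewrite /G2 /= /blaschke subrr mul0r.
have mF2 z : modulus z < 1 -> modulus (F2 z) = modulus z.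
  move=> z1; apply/eqP; rewrite eq_le (schwarz_lemma hF2 F21 F20) //=.
  have := schwarz_lemma hG2 G21 G20 (F21 z z1).
  by rewrite /G2 /F2 /= FK ?bKN //; exact: blaschke_disk.
have := holomorphic_isometry hF2 F20 mF2.
set c := _ * (_ / _) => F2E.
(* Any nonzero point of the disk determines |c|, because z -> c z preserves moduli. *)
have half1 : modulus ((1 / 2 : R)%:C)%C < 1.
  by rewrite modulus_real gtr0_norm; lra.
exists a, c; split=> //.
  have := mF2 _ half1; rewrite (F2E _ half1) modulusM -[RHS]mul1r.
  by apply: mulIf; rewrite modulus_real gtr0_norm; lra.
move=> z z1; have := F2E (blaschke a z) (blaschke_disk a1 z1).
rewrite /F2 /= blaschkeK // => ->.
by rewrite /blaschke -mulrA divfK // blaschke_den_neq0 // ltW.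
Qed.

End rigidity.

(** * Boundary values of disk automorphisms *)

Section circle_lift.
Context {R : realType}.
Local Notation C := (R[i]^o).
Implicit Types (s t x : R) (psi : R -> R).

Lemma cvg_moebius_relation {K : numFieldType} (T : Type) (F : set_system T)
    {FF : ProperFilter F} (f g : T -> K) (l e b c a : K) :
  f x @[x --> F] --> l -> g x @[x --> F] --> e ->
  (\forall x \near F, f x * (1 - b * g x) = c * (g x - a)) ->
  l * (1 - b * e) = c * (e - a).
Proof.
move=> fl ge fg.
have h1 : f x * (1 - b * g x) @[x --> F] --> l * (1 - b * e).
  apply: cvgM => //; apply: cvgB; first exact: cvg_cst.
  by apply: cvgM => //; exact: cvg_cst.
have h2 : c * (g x - a) @[x --> F] --> c * (e - a).
  apply: cvgM; first exact: cvg_cst.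
  by apply: cvgB => //; exact: cvg_cst.
have h3 : f x * (1 - b * g x) @[x --> F] --> c * (e - a).
  apply: cvg_trans h2; apply: near_eq_cvg.
  by apply: filterS fg => x ->.
exact: (cvg_unique _ h1 h3).
Qed.

Lemma modulus_circle_exp t : modulus (circle_exp t) = 1.
Proof.
apply/eqP; rewrite -(@eqrXn2 R 2) ?modulus_ge0 // sqr_modulus /=.
by rewrite cos2Dsin2 expr1n.
Qed.

Lemma circle_exp_cexp t : circle_exp t = cexp (t%:C%C * (0 +i* (2 * pi))%C).
Proof.
rewrite /circle_exp /cexp; congr (_ +i* _)%C => /=;
by rewrite !mul0r !mulr0 subr0 expR0 mul1r addr0 mulrC.
Qed.

(** Congruence modulo 1 is expressed as cos (2 pi x) = 1, which [cos2pi_neq1] excludes for 0 < x <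
    1. *)
Lemma circle_exp_eq s t : circle_exp s = circle_exp t ->
  cos (2 * pi * (s - t)) = 1.
Proof.
move=> [hc hs]; rewrite mulrBr cosB hc hs -!expr2; exact: cos2Dsin2.
Qed.

Lemma cos2pi_neq1 x : 0 < x < 1 -> cos (2 * pi * x) != 1.
Proof.
move=> /andP[x0 x1]; have pi0 := pi_gt0 R.
have : 0 < sin (pi * x).
  by apply: sin_gt0_pi; rewrite mulr_gt0 //= -[ltRHS]mulr1 ltr_pM2l.
move=> s0; apply/eqP.
have -> : 2 * pi * x = (pi * x) *+ 2 by rewrite mulr2n; ring.
rewrite cos_mulr2n cos2sin2 => h; have := sqr_ge0 (sin (pi * x)).
have : sin (pi * x) ^+ 2 = 0 by move: h; rewrite mulr2n; lra.
by move/eqP; rewrite sqrf_eq0 gt_eqF.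
Qed.

(** Makes the filter of the boundary limits proper, hence those limits unique. *)
Lemma closure_unit_disk t : closure (unit_disk R) (circle_exp t).
Proof.
move=> B /nbhs_ballP[e]; rewrite /= ltcE /= => /andP[/eqP e1 e0] eB.
pose k := Num.min (complex.Re e / 2) (1 / 2).
have [k0 k1 ke] : [/\ 0 < k, k < 1 & k < complex.Re e].
  by split; rewrite ?lt_min ?gt_min; lra.
exists ((1 - k)%:C%C * circle_exp t); split.
  rewrite unit_diskE modulusM modulus_circle_exp mulr1 modulus_real.
  by rewrite gtr0_norm; lra.
apply: eB; rewrite /ball /= normr_modulus.
have -> : e = ((complex.Re e)%:C)%C by case: (e) e1 => /= ? ? ->.
rewrite ltcR.
have -> : circle_exp t - (1 - k)%:C%C * circle_exp t = k%:C%C * circle_exp t.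
  by rewrite rmorphB /=; ring.
by rewrite modulusM modulus_circle_exp mulr1 modulus_real gtr0_norm.
Qed.

Lemma PSL2R_moebius psi : PSL2R psi ->
  exists a c : C, [/\ modulus a < 1, modulus c = 1 &
    forall t, circle_exp (psi t) * (1 - (a^*)%C * circle_exp t)
      = c * (circle_exp t - a)].
Proof.
move=> [_ [F /disk_automorphism_moebius[a [c [a1 c1 hF]]] Fpsi]].
exists a, c; split=> // t.
have PF : ProperFilter (within (unit_disk R) (nbhs (circle_exp t))).
  by apply: within_nbhs_proper; exact: closure_unit_disk.
apply: (@cvg_moebius_relation R[i] C _ PF F id _ _ _ _ _ (Fpsi t)).
  exact: cvg_within.
by apply: filterS (withinT _ _) => z; rewrite unit_diskE => /hF.
Qed.

(** Eliminating [w] leaves z - z' multiplied by c (1 - |a|^2), the determinant of the map. *)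
Lemma moebius_injective (a c z z' w : C) : modulus a < 1 -> modulus c = 1 ->
  w * (1 - (a^*)%C * z) = c * (z - a) ->
  w * (1 - (a^*)%C * z') = c * (z' - a) -> z = z'.
Proof.
move=> a1 c1 h h'.
have d : 1 - (a^*)%C * a != 0 by apply: blaschke_den_neq0 => //; exact: ltW.
have c0 : c != 0 by rewrite -modulus_eq0 c1 oner_eq0.
apply/eqP; rewrite -subr_eq0; apply/eqP/(mulIf d)/(mulfI c0).
rewrite mul0r mulr0.
have -> : c * ((z - z') * (1 - (a^*)%C * a)) =
   (c * (z - a)) * (1 - (a^*)%C * z') - (c * (z' - a)) * (1 - (a^*)%C * z).
  by ring.
by rewrite -h -h'; ring.
Qed.

(* The denominator of the Poisson kernel (1 - |a|^2) / |e^(2 pi i t) - a|^2. *)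
Definition poisson_den (a : C) t : R :=
  1 + modulus a ^+ 2 - 2 * complex.Re a * cos (2 * pi * t)
    - 2 * complex.Im a * sin (2 * pi * t).

Lemma poisson_denE a t : poisson_den a t = modulus (circle_exp t - a) ^+ 2.
Proof.
rewrite /poisson_den !sqr_modulus; case: a => a1 a2 /=.
have := cos2Dsin2 (2 * pi * t); set x := cos _; set y := sin _ => xy.
transitivity (x ^+ 2 + y ^+ 2 + (a1 ^+ 2 + a2 ^+ 2) - 2 * a1 * x - 2 * a2 * y).
  by rewrite xy.
by ring.
Qed.

Lemma poisson_den_gt0 a t : modulus a < 1 -> 0 < poisson_den a t.
Proof.
move=> a1; rewrite poisson_denE exprn_gt0 // lt_def modulus_ge0 andbT.
rewrite modulus_eq0 subr_eq0; apply/eqP => e.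
by move: a1; rewrite -e modulus_circle_exp ltxx.
Qed.

(** Only continuity of [psi] is known, but sin (2 pi (psi t - psi t0)) is a differentiable function
    of t by the Moebius relation, and near t0 the arcsine recovers [psi] from it. *)
Lemma PSL2R_derive psi (a c : C) : continuous psi -> modulus a < 1 ->
  modulus c = 1 ->
  (forall t, circle_exp (psi t) * (1 - (a^*)%C * circle_exp t)
      = c * (circle_exp t - a)) ->
  forall t, is_derive t (1 : R) psi ((1 - modulus a ^+ 2) / poisson_den a t).
Proof.
move=> cpsi a1 c1 H t0.
have pi0 := pi_gt0 R.
pose w0 := circle_exp (psi t0); pose z0 : C := (0 +i* (2 * pi))%C.
pose e0 : C := circle_exp t0.
have den t : 1 - (a^*)%C * circle_exp t != 0.
  by apply: blaschke_den_neq0 => //; rewrite modulus_circle_exp.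
have psiE t : circle_exp (psi t) = c * blaschke a (circle_exp t).
  by rewrite /blaschke mulrA -H mulfK.
pose S t := sin (2 * pi * (psi t - psi t0)).
(* Multiplying by the conjugate of w0 subtracts the angle at t0, and the real part of -i times a
   number is its imaginary part: the sine of the angle difference. *)
pose c' : C := - 'i%C * (w0^*)%C * c.
have SE t : S t = complex.Re (c' * (blaschke a \o cexp) (t%:C%C * z0)).
  rewrite /= -circle_exp_cexp /c' -!mulrA -psiE /S mulrBr sinB /w0 /circle_exp.
  by rewrite /=; ring.
pose K := 1 - modulus a ^+ 2.
have dS : is_derive t0 (1 : R) S (2 * pi * (K / poisson_den a t0)).
  have -> : S = (fun t => complex.Re (c' * (blaschke a \o cexp) (t%:C%C * z0))).
    by apply/funext.
  have z1 : modulus (cexp (t0%:C%C * z0)) <= 1.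
    by rewrite -circle_exp_cexp modulus_circle_exp.
  have := is_derive_ray c' (cderive_comp (is_derive_blaschke a1 z1)
    (is_derive_cexp _)).
  rewrite -circle_exp_cexp -/e0; congr is_derive.
  have w0E : w0 * (1 - (a^*)%C * e0) = c * (e0 - a) by exact: H.
  have w0J : (w0^*)%C = w0^-1.
    apply: (mulfI (x := w0)); first by rewrite -modulus_eq0 modulus_circle_exp oner_eq0.
    rewrite mulcJ modulus_circle_exp expr1n mulfV //.
    by rewrite -modulus_eq0 modulus_circle_exp oner_eq0.
  have e0J : e0 * (e0^*)%C = 1 by rewrite mulcJ modulus_circle_exp expr1n.
  have e0a : e0 - a != 0.
    by rewrite -modulus_eq0 -sqrf_eq0 -poisson_denE gt_eqF // poisson_den_gt0.
  have e0nz : e0 != 0 by rewrite -modulus_eq0 modulus_circle_exp oner_eq0.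
  have c0 : c != 0 by rewrite -modulus_eq0 c1 oner_eq0.
  have d0 : 1 - (a^*)%C * e0 != 0 by exact: den.
  have w00 : w0 != 0 by rewrite -modulus_eq0 modulus_circle_exp oner_eq0.
  (* On the circle the conjugate of e0 is its inverse, so |e0 - a|^2 becomes a rational expression
     in e0 and [field] can finish. *)
  have PE : (poisson_den a t0)%:C%C = (e0 - a) * (1 - (a^*)%C * e0) / e0 :> C.
    rewrite poisson_denE -/e0 -mulcJ.
    have -> : ((e0 - a)^*)%C = e0^-1 - (a^*)%C.
      rewrite rmorphB; congr (_ - _).
      by apply: (mulfI e0nz); rewrite e0J mulfV.
    by set b := (a^*)%C; field.
  have -> : c' * (K%:C%C / (1 - (a^*)%C * e0) ^+ 2 * e0 * z0) =
      (2 * pi * (K / poisson_den a t0))%:C%C.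
    have z0E : z0 = 'i%C * (2 * pi)%:C%C.
      by apply/eqP; rewrite eq_complex /=; apply/andP; split; apply/eqP; ring.
    have i2 : 'i%C * 'i%C = -1 :> C by rewrite -expr2 sqr_i.
    have -> : (2 * pi * (K / poisson_den a t0))%:C%C =
        2%:C%C * pi%:C%C * (K%:C%C / (poisson_den a t0)%:C%C) :> C.
      by rewrite !rmorphM fmorphV.
    rewrite PE /c' w0J z0E.
    have -> : c = w0 * (1 - (a^*)%C * e0) / (e0 - a).
      by rewrite w0E mulfK.
    transitivity (- ('i%C * 'i%C) * (2%:C%C * pi%:C%C * K%:C%C * e0 /
      ((e0 - a) * (1 - (a^*)%C * e0))) : C).
      have -> : (2 * pi)%:C%C = 2%:C%C * pi%:C%C :> C by rewrite rmorphM.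
      set b := (a^*)%C in d0 *; by field; rewrite d0 e0a w00.
    rewrite i2 opprK mul1r; set b := (a^*)%C in d0 *.
    by field; rewrite d0 e0a e0nz.
  by [].
have S0 : S t0 = 0 by rewrite /S subrr mulr0 sin0.
have dA : is_derive (S t0) (1 : R) (@asin R) 1.
  rewrite S0; have := @is_derive1_asin R 0; rewrite expr0n subr0 sqrtr1 invr1.
  by apply; rewrite ltr01 oppr_lt0 ltr01.
have dAS := @is_derive1_comp R (@asin R) S t0 _ _ dA dS.
have dT : is_derive t0 (1 : R) (fun t => psi t0 + (2 * pi)^-1 * asin (S t))
    (K / poisson_den a t0).
  apply: (@is_derive_eq _ _ _ _ _ _ _ _
    (is_deriveD (is_derive_cst (psi t0) t0 1)
      (is_deriveM (is_derive_cst ((2 * pi)^-1) t0 1) dAS))).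
  rewrite /GRing.scale /= mulr0 addr0 add0r mul1r mulrA mulVf ?mul1r //.
  by rewrite mulf_neq0 // gt_eqF.
apply: near_eq_is_derive dT.
(* A variation of [psi] below 1/4 keeps the angle within pi/2, where the arcsine inverts the
   sine. *)
have /cvgrPdist_lt /(_ (1 / 4)) := cpsi t0.
rewrite divr_gt0 // => /(_ isT); apply: filterS => t.
rewrite distrC ltr_norml => /andP[l r].
rewrite /S sinK; last first.
  have l' : 0 < psi t - psi t0 + 1 / 4 by lra.
  have r' : 0 < 1 / 4 - (psi t - psi t0) by lra.
  have := mulr_gt0 pi0 l'; have := mulr_gt0 pi0 r' => ? ?.
  by rewrite in_itv /=; apply/andP; split; lra.
by rewrite mulrA mulVf ?mul1r ?mulf_neq0 // ?gt_eqF // addrC subrK.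
Qed.

(** [psi] increases strictly and psi (t + 1) - psi t has cosine 1, so it cannot lie strictly between
    0 and 1. If it exceeded 1, the value psi t + 1 would be taken at some u inside ]t, t + 1[,
    against injectivity of the Moebius map on the circle. *)
Lemma PSL2R_translation psi (a c : C) : continuous psi -> modulus a < 1 ->
  modulus c = 1 ->
  (forall t, circle_exp (psi t) * (1 - (a^*)%C * circle_exp t)
      = c * (circle_exp t - a)) ->
  forall t, psi (t + 1) = psi t + 1.
Proof.
move=> cpsi a1 c1 H t.
have dpsi := PSL2R_derive cpsi a1 c1 H.
have K0 : 0 < 1 - modulus a ^+ 2 by rewrite subr_gt0 sqr_modulus_lt1.
have incr x y : x < y -> psi x < psi y.
  move=> xy; have [|u _ e] := MVT xy (fun z _ => dpsi z).
    exact: continuous_subspaceT.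
  rewrite -subr_gt0 e mulr_gt0 ?subr_gt0 // divr_gt0 //.
  exact: poisson_den_gt0.
have inj x y : circle_exp (psi x) = circle_exp (psi y) ->
    cos (2 * pi * (x - y)) = 1.
  move=> e; apply: circle_exp_eq.
  by apply: (moebius_injective a1 c1 (H x)); rewrite e; exact: H.
have per x : circle_exp (x + 1) = circle_exp x.
  have e : 2 * pi * (x + 1) = 2 * pi * x + pi *+ 2 by rewrite mulr2n; ring.
  by rewrite /circle_exp e (cosD2pi (2 * pi * x)) (sinD2pi (2 * pi * x)).
have tt1 : t < t + 1 by rewrite ltrDl.
have cosk : cos (2 * pi * (psi (t + 1) - psi t)) = 1.
  apply: circle_exp_eq.
  have den : 1 - (a^*)%C * circle_exp t != 0.
    by apply: blaschke_den_neq0 => //; rewrite modulus_circle_exp.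
  by apply: (mulIf den); rewrite H -{1}(per t) H per.
case: (ltgtP (psi (t + 1)) (psi t + 1)) => // h.
  have := @cos2pi_neq1 (psi (t + 1) - psi t).
  rewrite cosk eqxx subr_gt0 incr // ltrBlDl h => /(_ isT); by [].
have [|u] := @IVT R psi t (t + 1) (psi t + 1) (ltW tt1)
    (continuous_subspaceT cpsi).
  have le := ltW (incr _ _ tt1).
  by rewrite (min_idPl le) (max_idPr le) lerDl ler01 ltW.
rewrite in_itv /= => /andP[tu ut1] psiu.
have := inj u t; rewrite psiu per => /(_ erefl) e.
suff /cos2pi_neq1 : 0 < u - t < 1 by rewrite e eqxx.
have {}tu : t < u.
  rewrite lt_neqAle tu andbT; apply/eqP => e'.
  by move/eqP: psiu; rewrite -e' -subr_eq0 opprD addrA subrr sub0r oppr_eq0 oner_eq0.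
have {}ut1 : u < t + 1.
  rewrite lt_neqAle ut1 andbT; apply/eqP => e'.
  by move: h; rewrite -e' psiu ltxx.
by apply/andP; split; lra.
Qed.

End circle_lift.

(** * Weak derivatives on the circle *)

Section test_functions.
Context {R : realType}.
Notation mu := (@lebesgue_measure R).
Implicit Types (f g h k chi : R -> R) (a b t : R).

Lemma is_derive_derive1 f df : (forall t : R, is_derive t (1 : R) f (df t)) ->
  derive1 f = df.
Proof. by move=> H; apply/funext => t; rewrite derive1E; exact: derive_val. Qed.

Lemma is_derive_continuous f df : (forall t : R, is_derive t (1 : R) f (df t)) ->
  continuous f.
Proof.
move=> H t; apply: differentiable_continuous; apply/derivable1_diffP.
by have [] := H t.
Qed.

(** Smoothness is proved for a whole class closed under differentiation, which avoids formulas for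
    the iterated derivatives. *)
Lemma circle_test_fun_closed (S : set (R -> R)) :
  (forall f, S f -> periodic1 f) ->
  (forall f, S f -> exists2 df, S df &
     forall t : R, is_derive t (1 : R) f (df t)) ->
  forall f, S f -> circle_test_fun f.
Proof.
move=> Sper Sder f Sf; split=> [|n]; first exact: Sper.
suff Sn : S (derive1n n f) by move=> t; have [df _ /(_ t)[]] := Sder _ Sn.
elim: n => [//|n /Sder[df Sdf Hdf]].
by rewrite derive1nS (is_derive_derive1 Hdf).
Qed.

Lemma circle_test_fun_antiderivative f F : circle_test_fun f ->
  (forall t : R, is_derive t (1 : R) F (f t)) -> periodic1 F ->
  circle_test_fun F.
Proof.
move=> [_ df] dF pF; split => // -[|n] t; first by have [] := dF t.
by rewrite derive1Sn (is_derive_derive1 dF).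
Qed.

Section cutoff.
Variables (n : nat) (b : R).

(* [cos (2 pi t - pi b) - cos (pi b) = 2 sin (pi t) sin (pi (b - t))] is
   positive on ]0, b[ and negative on ]b, 1[. *)
Definition cutoff t : R :=
  (1 + expR (- (n%:R * (cos (2 * pi * t - pi * b) - cos (pi * b)))))^-1.

(** The derivative of [cutoff] is cutoff (1 - cutoff) times a multiple of the sine, so these
    generators span an algebra closed under differentiation. Periodicity and existence of
    derivatives then follow by induction. *)
Inductive cutoff_algebra : (R -> R) -> Prop :=
| cutoff_cst c : cutoff_algebra (fun=> c)
| cutoff_sin : cutoff_algebra (fun t => sin (2 * pi * t - pi * b))
| cutoff_cos : cutoff_algebra (fun t => cos (2 * pi * t - pi * b))
| cutoff_sigma : cutoff_algebra cutoff
| cutoff_add f g : cutoff_algebra f -> cutoff_algebra g ->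
    cutoff_algebra (fun t => f t + g t)
| cutoff_mul f g : cutoff_algebra f -> cutoff_algebra g ->
    cutoff_algebra (fun t => f t * g t).

Lemma is_derive_affine (c d : R) t : is_derive t (1 : R) (fun x => c * x - d) c.
Proof. by apply: is_derive_eq; rewrite /GRing.scale /=; ring. Qed.

Lemma is_derive_cos_affine (c d : R) t :
  is_derive t (1 : R) (fun x => cos (c * x - d)) (- sin (c * t - d) * c).
Proof.
exact: (@is_derive1_comp R cos _ t _ _ (is_derive_cos _) (is_derive_affine c d t)).
Qed.

Lemma is_derive_sin_affine (c d : R) t :
  is_derive t (1 : R) (fun x => sin (c * x - d)) (cos (c * t - d) * c).
Proof.
exact: (@is_derive1_comp R sin _ t _ _ (is_derive_sin _) (is_derive_affine c d t)).
Qed.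

Lemma is_derive_cutoff t : is_derive t (1 : R) cutoff
  (cutoff t * (1 - cutoff t) *
    (n%:R * (- sin (2 * pi * t - pi * b) * (2 * pi)))).
Proof.
have dc := is_derive_cos_affine (2 * pi) (pi * b) t.
pose u x : R := - (n%:R * (cos (2 * pi * x - pi * b) - cos (pi * b))).
have du : is_derive t (1 : R) u
    (- (n%:R * (- sin (2 * pi * t - pi * b) * (2 * pi)))).
  by apply: is_derive_eq; rewrite /GRing.scale /=; ring.
have de := @is_derive1_comp R (@expR R) u t _ _ (is_derive_expR _) du.
have d0 : 1 + expR (u t) != 0 by rewrite gt_eqF // ltr_wpDr ?expR_ge0.
have ds := is_deriveD (is_derive_cst (1 : R) t (1 : R)) de.
apply: (is_derive_eq (nf_is_deriveV (f := fun x => 1 + expR (u x)) d0 ds)).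
rewrite /cutoff -/(u t) /GRing.scale /=; field.
exact: d0.
Qed.

Lemma cutoff_algebra_test f : cutoff_algebra f -> circle_test_fun f.
Proof.
apply: circle_test_fun_closed => {}f.
  have e t : 2 * pi * (t + 1) - pi * b = 2 * pi * t - pi * b + pi *+ 2 :> R.
    by rewrite mulr2n; ring.
  have cs t := cosD2pi (2 * pi * t - pi * b).
  have ss t := sinD2pi (2 * pi * t - pi * b).
  elim=> [c| | | |g h _ pg _ ph|g h _ pg _ ph] t //=.
  - by rewrite e ss.
  - by rewrite e cs.
  - by rewrite /cutoff e cs.
  - by rewrite pg ph.
  - by rewrite pg ph.
elim=> [c| | | |g h Sg [dg Sdg Dg] Sh [dh Sdh Dh]
  |g h Sg [dg Sdg Dg] Sh [dh Sdh Dh]].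
- by exists (fun=> 0); [exact: cutoff_cst|move=> t; exact: is_derive_cst].
- exists (fun t => cos (2 * pi * t - pi * b) * (2 * pi)).
    by apply: cutoff_mul; [exact: cutoff_cos|exact: cutoff_cst].
  exact: is_derive_sin_affine.
- exists (fun t => sin (2 * pi * t - pi * b) * - (2 * pi)).
    by apply: cutoff_mul; [exact: cutoff_sin|exact: cutoff_cst].
  by move=> t; rewrite mulrN -mulNr; exact: is_derive_cos_affine.
- exists (fun t => cutoff t * (1 + -1 * cutoff t) *
    (- n%:R * (sin (2 * pi * t - pi * b) * (2 * pi)))).
    do ?[apply: cutoff_mul|apply: cutoff_add|exact: cutoff_sigma
      |exact: cutoff_sin|exact: cutoff_cst].
  move=> t; apply: (is_derive_eq (is_derive_cutoff t)); ring.
- exists (fun t => dg t + dh t); first exact: cutoff_add.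
  by move=> t; exact: is_deriveD.
- exists (fun t => g t * dh t + h t * dg t).
    by apply: cutoff_add; apply: cutoff_mul.
  by move=> t; exact: is_deriveM.
Qed.

End cutoff.

Lemma cutoff_bounds n b t : 0 <= cutoff n b t <= 1.
Proof.
set e := expR (- (n%:R * (cos (2 * pi * t - pi * b) - cos (pi * b)))).
have e0 : 0 <= e by exact: expR_ge0.
rewrite /cutoff -/e invr_ge0 addr_ge0 //= invf_le1; last by lra.
by lra.
Qed.

(** The logistic function saturates according to the sign of its argument. At 0, b and 1 the
    argument vanishes and the value stays 1/2, hence the exclusions. *)
Lemma cutoff_cvg b t : 0 < t < 1 -> 0 < b < 1 -> t != b ->
  cutoff n b t @[n --> \oo] --> (if t <= b then 1 else 0 : R).
Proof.
move=> /andP[t0 t1] /andP[b0 b1] tb; have pi0 := pi_gt0 R.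
pose x : R := cos (2 * pi * t - pi * b) - cos (pi * b).
have xE : x = 2 * (sin (pi * t) * sin (pi * (b - t))).
  rewrite /x; have -> : 2 * pi * t - pi * b = pi * t - pi * (b - t) by ring.
  have -> : cos (pi * b) = cos (pi * t + pi * (b - t)) by congr cos; ring.
  by rewrite cosB cosD; ring.
have spos (s : R) : 0 < s < 1 -> 0 < sin (pi * s).
  move=> /andP[s0 s1]; apply: sin_gt0_pi; rewrite mulr_gt0 //=.
  by rewrite -[ltRHS]mulr1 ltr_pM2l.
have st : 0 < sin (pi * t) by apply: spos; rewrite t0.
have cvg0 (y : R) : 0 < y -> expR (- (n%:R * y)) @[n --> \oo] --> (0 : R).
  move=> y0; have -> : (fun n : nat => expR (- (n%:R * y)))
      = (fun n => expR (- y) ^+ n).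
    by apply/funext => n; rewrite -mulrN expRM_natl.
  by apply: cvg_expr; rewrite ger0_norm ?expR_ge0 // expR_lt1 oppr_lt0.
case: (ltgtP t b) tb => // [tb _|bt _].
- have x0 : 0 < x.
    rewrite xE mulr_gt0 // mulr_gt0 //; apply: spos.
    by apply/andP; split; lra.
  rewrite -[X in _ --> X](invr1) -[X in X^-1]addr0.
  apply: cvgV; first by rewrite addr0 oner_eq0.
  by apply: cvgD; [exact: cvg_cst|exact: cvg0].
- have x0 : 0 < - x.
    have := spos (t - b); rewrite subr_gt0 bt /= => /(_ _)/wrap[]; first by lra.
    have -> : pi * (t - b) = - (pi * (b - t)) by ring.
    rewrite sinN => s; rewrite xE -mulrN -mulrN.
    by rewrite mulr_gt0 // mulr_gt0.
  have -> : (fun n => cutoff n b t) = (fun n =>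
      expR (- (n%:R * (- x))) * (expR (- (n%:R * (- x))) + 1)^-1).
    apply/funext => n; rewrite /cutoff -/x mulrN opprK.
    have e1 := expRxMexpNx_1 (n%:R * x).
    have ep := expR_gt0 (n%:R * x); have en := expR_gt0 (- (n%:R * x)).
    rewrite expRN; field.
    by rewrite !gt_eqF //; lra.
  rewrite -[X in _ --> X](mul0r (0 + 1)^-1).
  apply: cvgM; first exact: cvg0.
  apply: cvgV; first by rewrite add0r oner_eq0.
  by apply: cvgD; [exact: cvg0|exact: cvg_cst].
Qed.

End test_functions.

(** * The fundamental lemma of the calculus of variations on the circle *)

Section variational.
Context {R : realType}.
Notation mu := (@lebesgue_measure R).
Notation I01 := (unit_interval R).
Implicit Types (f g h k chi : R -> R) (a b t : R).

Lemma measurable_unit_interval : measurable (I01 : set (measurableTypeR R)).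
Proof. exact: measurable_itv. Qed.

Lemma measurable_bounded_continuous h : continuous h ->
  measurable_fun (I01 : set (measurableTypeR R)) h /\ [bounded h t | t in I01].
Proof.
move=> ch; have cI := continuous_subspaceT (A := I01) ch; split.
  exact: (subspace_continuous_measurable_fun measurable_unit_interval cI).
have /compact_bounded[M [_ mrt]] := continuous_compact cI (@segment_compact _ 0 1).
by exists M; split; rewrite ?num_real // => x Mx y Iy; apply: mrt => //; exists y.
Qed.

Lemma integrable_mul_continuous g h :
  mu.-integrable I01 (EFin \o g) -> continuous h ->
  mu.-integrable I01 (EFin \o (fun t => g t * h t)).
Proof.
move=> ig ch; have [mh bh] := measurable_bounded_continuous ch.
exact: (integrableMl measurable_unit_interval ig mh bh).
Qed.

Lemma integrable_continuous h :
  continuous h -> mu.-integrable I01 (EFin \o h).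
Proof. exact: continuous_integrable_cc. Qed.

(** For 0 < b < 1, testing against [cutoff n b] and letting n grow amounts to testing against the
    indicator of [0, b]; the convergence is dominated by |k|. *)
Lemma Rintegral_prefix_eq0 k :
  mu.-integrable I01 (EFin \o k) ->
  (forall chi, circle_test_fun chi -> \int[mu]_(t in I01) (k t * chi t) = 0) ->
  forall b, b <= 1 -> \int[mu]_(t in `[0, b]) k t = 0.
Proof.
move=> ik kchi b; have mI := measurable_unit_interval.
rewrite le_eqVlt => /orP[/eqP ->|b1].
  rewrite -[RHS](kchi (fun=> 1)); last first.
    exact: (@cutoff_algebra_test R 0 0 _ (cutoff_cst _ _ _)).
  by apply: eq_Rintegral => t _; rewrite mulr1.
have [b0|b0] := leP b 0.
  move: b0; rewrite le_eqVlt => /orP[/eqP ->|b0].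
    by rewrite set_itv1 Rintegral_set1.
  by rewrite set_itv_ge ?Rintegral_set0 // bnd_simp -ltNge.
pose f t := k t * \1_(`[0, b]) t.
have mk : measurable_fun (I01 : set (measurableTypeR R)) k.
  by apply/measurable_EFinP; exact: (measurable_int mu ik).
have cc n : continuous (cutoff n b : R -> R).
  exact: (is_derive_continuous (is_derive_cutoff n b)).
have icut n : mu.-integrable I01 (EFin \o (fun t => k t * cutoff n b t)).
  exact: integrable_mul_continuous.
have mf : measurable_fun (I01 : set (measurableTypeR R)) f.
  exact: measurable_funM.
have [] := @dominated_convergence _ _ _ mu I01 mI
  (fun n t => (k t * cutoff n b t)%:E) (fun t => (f t)%:E)
  (fun t => `|k t|%:E).
- by move=> n; exact: (measurable_int mu (icut n)).
- exact/measurable_EFinP.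
- have : mu.-negligible ([set 0; b; 1] : set R).
    exists [set 0; b; 1]; split => //.
      by apply: measurableU; [apply: measurableU|]; exact: measurable_set1.
    by apply: countable_lebesgue_measure0; apply: finite_set_countable;
      rewrite !finite_setU; do ?split; exact: finite_set1.
  apply: negligibleS => t /= /not_implyP[]; rewrite /unit_interval /= in_itv /=.
  move=> /andP[t0 t1] ncv; apply: contrapT => nt; apply: ncv.
  have [tn0 tb tn1] : [/\ t != 0, t != b & t != 1].
    by split; apply/eqP => e; apply: nt; rewrite e; [left;left|left;right|right].
  apply/fine_cvgP; split; first by apply: nearW.
  have t01 : 0 < t < 1 by rewrite !lt_neqAle t0 t1 eq_sym tn0 tn1.
  have b01 : 0 < b < 1 by rewrite b0.
  have -> : f t = k t * (if t <= b then 1 else 0).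
    rewrite /f indicE; congr (_ * _).
    have [tb'|tb'] := leP t b; first by rewrite mem_set //= in_itv /= t0.
    by rewrite memNset //= in_itv /= t0 /= [t <= b]leNgt tb'.
  apply: cvgM; first exact: cvg_cst.
  exact: cutoff_cvg.
- exact: integrable_norm.
- apply: aeW => t n _ /=; rewrite lee_fin normrM.
  have /andP[c0 c1] := cutoff_bounds n b t.
  by rewrite (ger0_norm c0) ler_piMr.
move=> intf _; set u := [sequence _]_n => cvu.
have u0 : u = (fun=> 0%E).
  apply/funext => n; rewrite /u /=.
  have := kchi _ (cutoff_algebra_test (cutoff_sigma n b)); rewrite /Rintegral.
  move=> /eqP; rewrite fine_eq0 //; last by apply: integrable_fin_num => //; exact: icut.
  by move=> /eqP.
have : (\int[mu]_(t in I01) (f t)%:E = 0)%E.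
  by rewrite u0 in cvu; rewrite -(cvg_lim (@ereal_hausdorff R) cvu) lim_cst.
move=> /(congr1 fine); rewrite /= => f0.
have := @Rintegral_itvB _ f (BLeft 0) (BRight 1) b.
rewrite !bnd_simp => /(_ intf (ltW b0) (ltW b1)).
rewrite [X in X - _ = _ -> _]f0 sub0r.
rewrite [RHS](_ : _ = 0); last first.
  rewrite (@eq_Rintegral _ _ _ _ _ (fun=> 0)) ?Rintegral_cst ?mul0r //.
  move=> t; rewrite inE /= in_itv /= => /andP[bt t1].
  by rewrite /f indicE memNset ?mulr0 //= in_itv /= [t <= b]leNgt bt andbF.
move=> /eqP; rewrite oppr_eq0 => /eqP fb0; rewrite -[RHS]fb0.
by apply: eq_Rintegral => t tb; rewrite /f indicE tb mulr1.
Qed.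

(** The extension of [k] by 0 has a vanishing primitive, and Lebesgue differentiation returns [k]
    almost everywhere. *)
Lemma fundamental_lemma k :
  mu.-integrable I01 (EFin \o k) ->
  (forall chi, circle_test_fun chi -> \int[mu]_(t in I01) (k t * chi t) = 0) ->
  {ae mu, forall t, I01 t -> k t = 0}.
Proof.
move=> ik kchi; have mI := measurable_unit_interval.
have intT : mu.-integrable setT (EFin \o (k \_ I01)).
  by rewrite -restrict_EFin; exact: ((integrable_mkcond _ mI).1 ik).
have := @FTC1Ny R (k \_ I01).
move=> /(_ _ (integrable_locally mI ik))/wrap[].
  by move=> y; apply: integrableS intT.
have F0 : (fun x => \int[mu]_(t in `]-oo, x]) (k \_ I01) t) = fun=> 0.
  apply/funext => x; rewrite -Rintegral_mkcondr.
  have -> : `]-oo, x]%classic `&` I01 = `[0, Num.min x 1]%classic.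
    apply/seteqP; split => t; rewrite /unit_interval /= !in_itv /= le_min.
      by move=> [-> /andP[-> ->]].
    by move=> /and3P[-> -> ->].
  by apply: Rintegral_prefix_eq0 => //; rewrite ge_min lexx orbT.
rewrite F0; apply: filterS; first exact: (ae_filter_ringOfSetsType mu).
by move=> t [_] + It; rewrite derive1_cst /patch mem_set // => <-.
Qed.

(** This makes the choice inside [weak_derivative] harmless: the integral in [action] does not see
    null sets. *)
Lemma weak_derivative_unique f g h :
  is_weak_derivative f g -> is_weak_derivative f h ->
  {ae mu, forall t, I01 t -> g t = h t}.
Proof.
move=> [ig Hg] [ih Hh]; have mI := measurable_unit_interval.
have := @fundamental_lemma (fun t => g t - h t).
move=> /(_ _ _)/wrap[].
- by have := integrableB mI ig ih.
- move=> chi tchi; have cchi : continuous chi.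
    move=> t; apply: differentiable_continuous; apply/derivable1_diffP.
    exact: (tchi.2 0%N t).
  under eq_Rintegral do rewrite mulrBl.
  rewrite RintegralB //; try exact: integrable_mul_continuous.
  apply/eqP; rewrite subr_eq0 -eqr_opp; apply/eqP.
  by rewrite -Hg // -Hh.
apply: filterS; first exact: (ae_filter_ringOfSetsType mu).
by move=> t H It; apply/eqP; rewrite -subr_eq0; apply/eqP/H.
Qed.

End variational.

(** * Approximation of primitives of integrable functions *)

Section absolutely_continuous.
Context {R : realType}.
Notation mu := (@lebesgue_measure R).
Notation I01 := (unit_interval R).
Implicit Types (f g h k w chi : R -> R) (a b c e t M : R).

(** The primitive must exist on both sides of 0. Integrals starting at -N are normalised to vanish
    at 0; the result does not depend on N, which may therefore vary with t. *)
Lemma continuous_primitive f : continuous f ->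
  exists2 F : R -> R, F 0 = 0 & forall t : R, is_derive t (1 : R) F (f t).
Proof.
move=> cf.
pose P (N t : R) := \int[mu]_(x in `[- N, t]) f x - \int[mu]_(x in `[- N, 0]) f x.
have PE N M t : 0 <= M -> M <= N -> - M <= t -> P N t = P M t.
  move=> M0 MN Mt; rewrite /P.
  rewrite (Rintegral_cc_split cf (a := - N) (c := - M) (b := t)) ?lerN2 //.
  rewrite (Rintegral_cc_split cf (a := - N) (c := - M) (b := 0)) ?lerN2 ?oppr_le0 //.
  by ring.
exists (fun t => P (`|t| + 1) t) => [|t]; first by rewrite /P subrr.
(* A single N for the whole unit ball around t, where |x| + 1 <= |t| + 2. *)
pose N := `|t| + 2.
have nt : - N < t by have := lerNnormlW (lexx `|t|); rewrite /N; lra.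
have dP : is_derive t (1 : R) (P N) (f t).
  have [] := @continuous_FTC1_closed R f (- N) t (t + 1) _ _ nt (cf t).
  - by rewrite ltrDl.
  - exact: continuous_integrable_cc.
  move=> dF eF; have := is_deriveB (DeriveDef dF erefl)
    (is_derive_cst (\int[mu]_(x in `[- N, 0]) f x) t (1 : R)).
  by rewrite subr0 -derive1E eF.
apply: near_eq_is_derive dP; apply/nbhs_ballP; exists 1 => //= x.
rewrite /ball /= => xt; apply: PE; first by rewrite addr_ge0.
  by have := ler_normB t (t - x); rewrite /N opprB addrC subrK; lra.
by have := lerNnormlW (lexx `|x|); lra.
Qed.

Lemma continuous_bounded_unit h : continuous h ->
  exists2 M, 0 <= M & forall t, I01 t -> `|h t| <= M.
Proof.
move=> ch; have [_ [M [_ bM]]] := measurable_bounded_continuous ch.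
exists (`|M| + 1); first by rewrite addr_ge0.
by move=> t It; apply: bM => //=; rewrite ltr_pwDr // ler_norm.
Qed.

Lemma Rintegral_mul_le g h M : mu.-integrable I01 (EFin \o g) ->
  mu.-integrable I01 (EFin \o (fun t => g t * h t)) ->
  (forall t, I01 t -> `|h t| <= M) ->
  `|\int[mu]_(t in I01) (g t * h t)| <= (\int[mu]_(t in I01) `|g t|) * M.
Proof.
move=> ig igh hM; have mI := (@measurable_unit_interval R).
apply: le_trans (le_normr_Rintegral mI igh) _.
have ing : mu.-integrable I01 (EFin \o (fun t => `|g t|)) by exact: integrable_norm.
rewrite -RintegralZr //; apply: le_Rintegral => //.
- exact: (integrable_norm igh).
- by apply: (integrable_mul_continuous (h := fun=> M)) => // x; exact: cvg_cst.
- by move=> t It; rewrite normrM ler_wpM2l // hM.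
Qed.

(** A violation at t would persist on a neighbourhood, whose trace on [0, 1] has positive length
    even when t is an endpoint. *)
Lemma ae_le_continuous f M : continuous f ->
  {ae mu, forall t, I01 t -> f t <= M} -> forall t, I01 t -> f t <= M.
Proof.
move=> cf [N [mN N0 sN]] t; rewrite /unit_interval /= in_itv /= => /andP[t0 t1].
rewrite leNgt; apply/negP => ft.
have ft' : 0 < f t - M by lra.
have /cvgrPdist_lt /(_ _ ft') /nbhs_ballP[d /= d0 hd] := cf t.
pose a := Num.max 0 (t - d / 2); pose b := Num.min 1 (t + d / 2).
have [a0 ad bd b1 ab] : [/\ 0 <= a, t - d / 2 <= a, b <= t + d / 2, b <= 1 & a < b].
  split; rewrite ?lt_min ?gt_max ?le_max ?ge_min ?lexx ?orbT //.
  by apply/andP; split; apply/andP; split; lra.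
have : (mu (`[a, b] : set R) <= mu N)%E.
  apply: le_measure; rewrite ?inE //.
  move=> s; rewrite /= in_itv /= => /andP[as_ sb]; apply: sN => /= H.
  have := hd s; rewrite /ball /= => /(_ _)/wrap[].
    by rewrite ltr_norml; apply/andP; split; lra.
  have : f s <= M by apply: H; rewrite /unit_interval /= in_itv /=; apply/andP; split; lra.
  by rewrite ltr_norml => ? /andP[]; lra.
rewrite N0 lebesgue_measure_itv /= lte_fin ab -EFinD lee_fin; lra.
Qed.

Variable g : R -> R.
Hypothesis ig : mu.-integrable I01 (EFin \o g).
Let W t := \int[mu]_(x in `[0, t]) g x.

(** By density of continuous functions in L^1; an L^1 error bounds the error of the primitives
    uniformly. This transfers identities from the classical fundamental theorem to integrable
    [g]. *)
Lemma continuous_approximation e : 0 < e ->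
  exists g1 G : R -> R, [/\ continuous g1, G 0 = 0,
    forall t : R, is_derive t (1 : R) G (g1 t),
    \int[mu]_(t in I01) `|g t - g1 t| <= e &
    forall t, I01 t -> `|W t - G t| <= e].
Proof.
move=> e0; have mI := (@measurable_unit_interval R).
have muI : (mu I01 < +oo)%E by rewrite /unit_interval lebesgue_measure_itv /= lte01 ltry.
have [gn [cgn ign]] := approximation_continuous_integrable mI muI ig.
move=> /fine_cvgP[_] /cvgrPdist_le /(_ _ e0)[n _ /(_ n (leqnn n))].
rewrite /= sub0r normrN => Hn.
have {}Hn : \int[mu]_(t in I01) `|g t - gn n t| <= e by exact: le_trans (ler_norm _) Hn.
have [G G0 dG] := continuous_primitive (cgn n).
exists (gn n), G; split=> // t; rewrite /unit_interval /= in_itv /= => /andP[t0 t1].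
have sub : `[0, t]%classic `<=` I01.
  move=> s; rewrite /unit_interval /= !in_itv /= => /andP[-> st] /=.
  exact: le_trans t1.
have -> : G t = \int[mu]_(x in `[0, t]) gn n x.
  by rewrite (Rintegral_cc_FTC (cgn n) t0 dG) G0 subr0.
have mt : measurable (`[0, t] : set (measurableTypeR R)) by exact: measurable_itv.
have ig' := integrableS mI mt sub ig; have ign' := integrableS mI mt sub (ign n).
rewrite /W -RintegralB //.
have igB : mu.-integrable I01 (EFin \o (fun t => g t - gn n t)).
  by have := integrableB mI ig (ign n).
apply: le_trans (le_normr_Rintegral mt (integrableS mI mt sub igB)) _.
apply: le_trans Hn; rewrite /Rintegral fine_le //.
- by apply: integrable_fin_num => //; exact: (integrable_norm (integrableS mI mt sub igB)).
- by apply: integrable_fin_num => //; exact: (integrable_norm igB).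
- apply: ge0_subset_integral => //.
  by have /(measurable_int mu) := integrable_norm igB.
Qed.

End absolutely_continuous.

(** * Weak derivatives as integrands of primitives *)

Section weak_calculus.
Context {R : realType}.
Notation mu := (@lebesgue_measure R).
Notation I01 := (unit_interval R).
Implicit Types (f g h k w chi : R -> R) (a b c e t M : R).

Lemma unit_interval0 : I01 0. Proof. by rewrite /unit_interval /= in_itv /= lexx ler01. Qed.
Lemma unit_interval1 : I01 1. Proof. by rewrite /unit_interval /= in_itv /= lexx ler01. Qed.

(** Closes the approximation arguments, where all errors are linear in e. The restriction e <= 1
    lets exponentials be bounded independently of e. *)
Lemma linear_small_eq0 (x C : R) :
  (forall e, 0 < e -> e <= 1 -> `|x| <= C * e) -> x = 0.
Proof.
move=> H; apply/eqP; rewrite -normr_le0 leNgt; apply/negP => x0.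
have C0 : 0 < C by have := H 1 ltr01 (lexx 1); rewrite mulr1; apply: lt_le_trans.
pose e := Num.min 1 (`|x| / (2 * C)).
have e0 : 0 < e by rewrite lt_min ltr01 divr_gt0 // mulr_gt0.
have e1 : e <= 1 by rewrite ge_min lexx.
have : C * e <= `|x| / 2.
  have -> : `|x| / 2 = C * (`|x| / (2 * C)) by field; rewrite gt_eqF.
  by rewrite ler_pM2l // ge_min lexx orbT.
by have := H e e0 e1; lra.
Qed.

Lemma integrable_primitive g : mu.-integrable I01 (EFin \o g) ->
  mu.-integrable I01 (EFin \o (fun t => \int[mu]_(x in `[0, t]) g x)).
Proof.
move=> ig; apply: continuous_compact_integrable; first exact: segment_compact.
exact: (@parameterized_integral_continuous R 0 1 g ler01 ig).
Qed.

(** Exact for the continuous approximation of [g] and its primitive. Passing to [g] costs e N in the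
    first integral, e M in the second and e M in the boundary term. *)
Lemma weak_integration_by_parts g chi dchi :
  mu.-integrable I01 (EFin \o g) -> continuous dchi ->
  (forall t : R, is_derive t (1 : R) chi (dchi t)) ->
  let W t := \int[mu]_(x in `[0, t]) g x in
  \int[mu]_(t in I01) (W t * dchi t) + \int[mu]_(t in I01) (g t * chi t)
  = W 1 * chi 1.
Proof.
move=> ig cd dchiP W; have mI := @measurable_unit_interval R.
have cchi := is_derive_continuous dchiP.
have iW : mu.-integrable I01 (EFin \o W) by exact: integrable_primitive.
have [M M0 HM] := continuous_bounded_unit cchi.
have [N N0 HN] := continuous_bounded_unit cd.
apply/eqP; rewrite -subr_eq0; apply/eqP.
apply: (@linear_small_eq0 _ (N + 2 * M)) => e e0 _.
have [g1 [G [cg1 G0 dG Hg HW]]] := continuous_approximation ig e0.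
have cG := is_derive_continuous dG.
have ig1 := integrable_continuous cg1; have iG := integrable_continuous cG.
have igg : mu.-integrable I01 (EFin \o (fun t => g t - g1 t)).
  by have := integrableB mI ig ig1.
have iWG : mu.-integrable I01 (EFin \o (fun t => W t - G t)).
  by have := integrableB mI iW iG.
have FTC : \int[mu]_(t in I01) (G t * dchi t) + \int[mu]_(t in I01) (g1 t * chi t)
   = G 1 * chi 1.
  rewrite -RintegralD //; try exact: integrable_mul_continuous.
  have cF : continuous (fun t => G t * dchi t + g1 t * chi t).
    by move=> t; apply: cvgD; apply: cvgM;
      [exact: cG|exact: cd|exact: cg1|exact: cchi].
  have dF (t : R) : is_derive t (1 : R) (fun t => G t * chi t)
      (G t * dchi t + g1 t * chi t).
    by apply: (is_derive_eq (is_deriveM (dG t) (dchiP t)));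
      rewrite /GRing.scale /=; ring.
  by rewrite (Rintegral_cc_FTC cF ler01 dF) G0 mul0r subr0.
have -> : \int[mu]_(t in I01) (W t * dchi t) + \int[mu]_(t in I01) (g t * chi t)
    - W 1 * chi 1 =
  \int[mu]_(t in I01) ((W t - G t) * dchi t)
  + \int[mu]_(t in I01) ((g t - g1 t) * chi t) - (W 1 - G 1) * chi 1.
  under [in RHS]eq_Rintegral do rewrite mulrBl.
  rewrite [in RHS]RintegralB //; try exact: integrable_mul_continuous.
  have -> : \int[mu]_(t in I01) ((g t - g1 t) * chi t) =
    \int[mu]_(t in I01) (g t * chi t) - \int[mu]_(t in I01) (g1 t * chi t).
    rewrite -RintegralB //; try exact: integrable_mul_continuous.
    by apply: eq_Rintegral => t _; rewrite mulrBl.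
  by rewrite [in RHS]mulrBl -FTC; ring.
have B1 : `|\int[mu]_(t in I01) ((W t - G t) * dchi t)| <= e * N.
  have iA : mu.-integrable I01 (EFin \o (fun t => (W t - G t) * dchi t)).
    exact: integrable_mul_continuous.
  apply: le_trans (le_normr_Rintegral mI iA) _.
  have -> : e * N = \int[mu]_(t in I01) (e * N).
    by rewrite /unit_interval Rintegral_cc_cst // subr0 mulr1.
  apply: le_Rintegral => //; first exact: (integrable_norm iA).
    by apply: integrable_continuous => t; exact: cvg_cst.
  by move=> t It; rewrite normrM; apply: ler_pM => //; [exact: HW|exact: HN].
have B2 : `|\int[mu]_(t in I01) ((g t - g1 t) * chi t)| <= e * M.
  apply: le_trans (Rintegral_mul_le igg _ HM) _.
    exact: integrable_mul_continuous.
  exact: ler_wpM2r.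
have B3 : `|(W 1 - G 1) * chi 1| <= e * M.
  by rewrite normrM; apply: ler_pM => //; [apply: HW|apply: HM];
    exact: unit_interval1.
move: B1 B2 B3; set X := \int[mu]_(t in I01) _; set Y := \int[mu]_(t in I01) _.
set Z := (W 1 - G 1) * chi 1 => B1 B2 B3.
have := ler_normD (X + Y) (- Z); have := ler_normD X Y; rewrite normrN.
lra.
Qed.

Lemma periodic1_derive1 f : periodic1 f -> periodic1 (derive1 f).
Proof.
move=> pf t; rewrite /derive1.
have -> // : (fun x : R => x^-1 *: (f (x + (t + 1)) - f (t + 1))) =
  (fun x : R => x^-1 *: (f (x + t) - f t)).
by apply/funext => x; rewrite addrA !pf.
Qed.

Lemma circle_test_fun_addc chi c : circle_test_fun chi ->
  circle_test_fun (fun t => chi t + c).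
Proof.
move=> [pchi dchi]; apply: (@circle_test_fun_closed R
  [set f | exists n d, f = (fun t => derive1n n chi t + d)]).
- move=> _ [n [d ->]] t; congr (_ + _).
  elim: n t => [//|n IH]; rewrite derive1nS; exact: periodic1_derive1.
- move=> _ [n [d ->]]; exists (derive1n n.+1 chi).
    by exists n.+1, 0; apply/funext => t; rewrite addr0.
  move=> t; have := is_deriveD (DeriveDef (dchi n t) erefl)
    (is_derive_cst d t (1 : R)).
  by rewrite addr0 -derive1E -derive1nS.
- by exists 0%N, c.
Qed.

(** The du Bois-Reymond argument: the difference of [w] and the primitive of [g] is orthogonal to
    derivatives of test functions, that is, to test functions of mean 0, hence is constant almost
    everywhere. Testing with 1 gives the mean of [g], which removes the boundary term for the
    primitive. *)
Lemma weak_derivative_primitive w g : continuous w -> is_weak_derivative w g ->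
  exists c, [/\ \int[mu]_(t in I01) g t = 0 &
    {ae mu, forall t, I01 t -> w t = c + \int[mu]_(x in `[0, t]) g x}].
Proof.
move=> cw [ig Hg]; have mI := @measurable_unit_interval R.
have ccst (d : R) : continuous (fun _ : R => d) by move=> t; exact: cvg_cst.
pose W t := \int[mu]_(x in `[0, t]) g x.
have iW : mu.-integrable I01 (EFin \o W) by exact: integrable_primitive.
have iw := integrable_continuous cw.
have iwW : mu.-integrable I01 (EFin \o (fun t => w t - W t)).
  by have := integrableB mI iw iW.
have test1 : circle_test_fun (fun=> 1 : R).
  exact: (@cutoff_algebra_test R 0 0 _ (cutoff_cst _ _ _)).
have g0 : \int[mu]_(t in I01) g t = 0.
  have := Hg _ test1.
  under eq_Rintegral do rewrite derive1_cst mulr0.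
  rewrite Rintegral_cst // mul0r => /esym/eqP; rewrite oppr_eq0 => /eqP.
  by under eq_Rintegral do rewrite mulr1.
have tderiv chi : circle_test_fun chi ->
    (forall t : R, is_derive t (1 : R) chi (derive1 chi t)) /\ continuous (derive1 chi).
  move=> [_ d]; split=> t.
    by rewrite derive1E; apply: DeriveDef => //; exact: (d 0%N t).
  apply: differentiable_continuous; apply/derivable1_diffP.
  by have := d 1%N t; rewrite derive1n1.
have HwW chi : circle_test_fun chi ->
    \int[mu]_(t in I01) ((w t - W t) * derive1 chi t) = 0.
  move=> tchi; have [d1 d2] := tderiv chi tchi.
  have ibp : \int[mu]_(t in I01) (W t * derive1 chi t) +
      \int[mu]_(t in I01) (g t * chi t) = 0.
    by rewrite (weak_integration_by_parts ig d2 d1) g0 mul0r.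
  under eq_Rintegral do rewrite mulrBl.
  rewrite RintegralB //; try exact: integrable_mul_continuous.
  by rewrite Hg //; apply/eqP; rewrite -opprD oppr_eq0 addrC ibp.
pose c := \int[mu]_(t in I01) (w t - W t).
exists c; split=> //.
have ik : mu.-integrable I01 (EFin \o (fun t => w t - W t - c)).
  have := integrableB mI iwW (integrable_continuous (@ccst c)).
  exact.
have := fundamental_lemma ik; move=> /(_ _)/wrap[]; last first.
  apply: filterS; first exact: (ae_filter_ringOfSetsType mu).
  by move=> t H It; have := H It; rewrite /W; lra.
move=> eta teta.
have [deta _] := tderiv eta teta; have ceta := is_derive_continuous deta.
pose m := \int[mu]_(t in I01) eta t.
have ceta' : continuous (fun t => eta t + - m).
  by move=> t; apply: cvgD; [exact: ceta|exact: cvg_cst].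
(* Subtracting the mean m from eta is what makes its primitive periodic, hence a test function. *)
have [F F0 dF] := continuous_primitive ceta'.
have F1 : F 1 = 0.
  have := Rintegral_cc_FTC ceta' ler01 dF; rewrite F0 subr0 => <-.
  have cm := ccst (- m).
  rewrite RintegralD //; try exact: integrable_continuous.
  by rewrite -/m Rintegral_cc_cst // subr0 mulr1 subrr.
have tF : circle_test_fun F.
  apply: (circle_test_fun_antiderivative (circle_test_fun_addc (- m) teta) dF).
  move=> t; apply/eqP; rewrite -subr_eq0; apply/eqP.
  have := @is_derive_0_is_cst R (fun t => F (t + 1) - F t) t 0.
  rewrite add0r F1 F0 subr0; apply => x.
  have ds : is_derive x (1 : R) (fun y => y + 1) 1.
    by apply: is_derive_eq; rewrite addr0.
  have := is_deriveB (@is_derive1_comp R F _ x _ _ (dF (x + 1)) ds) (dF x).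
  by rewrite mulr1 (teta.1 x) subrr.
have FE : derive1 F = (fun t => eta t + - m) by exact: is_derive_derive1.
have := HwW F tF; rewrite FE => HF.
(* The first integral vanishes by orthogonality; the second is c m - c m. *)
transitivity (\int[mu]_(t in I01) ((w t - W t) * (eta t - m))
   + \int[mu]_(t in I01) ((w t - W t) * m - c * eta t)).
  rewrite -RintegralD //.
  - by apply: eq_Rintegral => t _; ring.
  - exact: integrable_mul_continuous.
  - have i1 := integrable_mul_continuous iwW (@ccst m).
    have ce : continuous (fun t => c * eta t).
      by move=> t; apply: cvgM; [exact: cvg_cst|exact: ceta].
    by have := integrableB mI i1 (integrable_continuous ce).
rewrite HF add0r RintegralB //.
- by rewrite RintegralZr // RintegralZl ?subrr //; exact: integrable_continuous.
- exact: (integrable_mul_continuous iwW (@ccst m)).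
- apply: integrable_continuous => t.
  by apply: cvgM; [exact: cvg_cst|exact: ceta].
Qed.

End weak_calculus.

(** * Integration by parts against the exponential of a weakly differentiable function *)

Section weak_exponential.
Context {R : realType}.
Notation mu := (@lebesgue_measure R).
Notation I01 := (unit_interval R).
Implicit Types (f g h k w chi : R -> R) (a b c e t M : R).

Lemma expR_lipschitz (x y B : R) : x <= B -> y <= B ->
  `|expR x - expR y| <= expR B * `|x - y|.
Proof.
wlog xy : x y / x <= y => [H xB yB|xB yB].
  case: (leP x y) => [|/ltW] h; first exact: H.
  by rewrite distrC [`|x - y|]distrC; exact: H.
have exy : expR x <= expR y by rewrite ler_expR.
rewrite ler0_norm ?subr_le0 // ler0_norm ?subr_le0 // !opprB.
apply: (@le_trans _ _ (expR y * (y - x))).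
  have := expR_ge1Dx (x - y); have ey := expR_ge0 y.
  move=> /(ler_wpM2l ey); rewrite -expRD [y + _]addrC subrK.
  lra.
by rewrite ler_wpM2r ?subr_ge0 // ler_expR.
Qed.

(** The product of e^w and k need not be a test function. With w replaced by v = c + G, where v' =
    g1, the fundamental theorem applies; three integral errors and a small boundary term remain. *)
Lemma weak_derivative_expR w g k dk : continuous w -> is_weak_derivative w g ->
  continuous dk -> (forall t : R, is_derive t (1 : R) k (dk t)) -> k 1 = k 0 ->
  \int[mu]_(t in I01) (g t * (expR (w t) * k t)) =
  - \int[mu]_(t in I01) (expR (w t) * dk t).
Proof.
move=> cw wg cdk dkP k10; have mI := @measurable_unit_interval R.
have [c [g0 wcW]] := weak_derivative_primitive cw wg.
have [ig _] := wg; have ck := is_derive_continuous dkP.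
have [B B0 HB] := continuous_bounded_unit cw.
have [M M0 HM] := continuous_bounded_unit ck.
have [N N0 HN] := continuous_bounded_unit cdk.
pose E := expR (B + 1); have E0 : 0 <= E by exact: expR_ge0.
pose n1 := \int[mu]_(t in I01) `|g t|.
apply/eqP; rewrite -subr_eq0 opprK; apply/eqP.
apply: (@linear_small_eq0 _ _ (n1 * (E * M) + E * M + E * N + E * M)) => e e0 e1.
have [g1 [G [cg1 G0 dG Hg HW]]] := continuous_approximation ig e0.
have cG := is_derive_continuous dG.
pose v t := c + G t.
have cv : continuous v.
  by move=> t; apply: cvgD; [exact: cvg_cst|exact: cG].
have dv (t : R) : is_derive t (1 : R) v (g1 t).
  by have := is_deriveD (is_derive_cst c t (1 : R)) (dG t); rewrite add0r.
have aeW : {ae mu, forall t, I01 t -> `|w t - v t| <= e}.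
  apply: filterS wcW; first exact: (ae_filter_ringOfSetsType mu).
  move=> t H It; rewrite (H It) /v.
  have -> : forall x : R, c + x - (c + G t) = x - G t by move=> x; ring.
  exact: HW.
(* The approximation holds almost everywhere, because [w] is a primitive of [g] only up to a null
   set; continuity of [w] and [v] extends it to every point. *)
have wv t : I01 t -> `|w t - v t| <= e.
  move=> It; rewrite ler_norml; apply/andP; split; last first.
    apply: (@ae_le_continuous R (fun t => w t - v t)) => //.
      by move=> x; apply: cvgB; [exact: cw|exact: cv].
    apply: filterS aeW; first exact: (ae_filter_ringOfSetsType mu).
    by move=> x /[apply]; rewrite ler_norml => /andP[].
  rewrite lerNl -[- _]/(- (w t - v t)) opprB.
  apply: (@ae_le_continuous R (fun t => v t - w t)) => //.
    by move=> x; apply: cvgB; [exact: cv|exact: cw].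
  apply: filterS aeW; first exact: (ae_filter_ringOfSetsType mu).
  by move=> x /[apply]; rewrite ler_norml => /andP[? _]; lra.
(* Since e <= 1, v exceeds the bound B of w by at most 1; this is why [E] is the exponential of B +
   1. *)
have wB t : I01 t -> w t <= B + 1 /\ v t <= B + 1.
  move=> It; have := HB t It; have := wv t It; rewrite !ler_norml.
  by move=> /andP[? ?] /andP[? ?]; split; lra.
have Ev t : I01 t -> expR (v t) <= E.
  by move=> /wB[_ ?]; rewrite ler_expR.
have Ewv t : I01 t -> `|expR (w t) - expR (v t)| <= E * e.
  move=> It; have [w1 v1] := wB t It.
  by apply: le_trans (expR_lipschitz w1 v1) _; rewrite ler_wpM2l // wv.
have cew : continuous (fun t => expR (w t)).
  by move=> t; apply: continuous_comp; [exact: cw|exact: continuous_expR].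
have cev : continuous (fun t => expR (v t)).
  by move=> t; apply: continuous_comp; [exact: cv|exact: continuous_expR].
have cM (f h : R -> R) : continuous f -> continuous h ->
    continuous (fun t => f t * h t).
  by move=> cf ch t; apply: cvgM; [exact: cf|exact: ch].
have cB (f h : R -> R) : continuous f -> continuous h ->
    continuous (fun t => f t - h t).
  by move=> cf ch t; apply: cvgB; [exact: cf|exact: ch].
have ig1 := integrable_continuous cg1.
have igg : mu.-integrable I01 (EFin \o (fun t => g t - g1 t)).
  by have := integrableB mI ig ig1.
have FTC : \int[mu]_(t in I01) (g1 t * (expR (v t) * k t))
    + \int[mu]_(t in I01) (expR (v t) * dk t) =
    (expR (v 1) - expR (v 0)) * k 0.
  have cF : continuous (fun t => g1 t * (expR (v t) * k t) + expR (v t) * dk t).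
    move=> t; apply: cvgD; first exact: (cM _ _ cg1 (cM _ _ cev ck)).
    exact: (cM _ _ cev cdk).
  have dF (t : R) : is_derive t (1 : R) (fun t => expR (v t) * k t)
      (g1 t * (expR (v t) * k t) + expR (v t) * dk t).
    have de := @is_derive1_comp R (@expR R) v t _ _ (is_derive_expR _) (dv t).
    apply: (is_derive_eq (is_deriveM de (dkP t))).
    by rewrite /GRing.scale /=; ring.
  rewrite -RintegralD //; last 2 first.
  - exact: (integrable_mul_continuous ig1 (cM _ _ cev ck)).
  - exact: (integrable_continuous (cM _ _ cev cdk)).
  by rewrite (Rintegral_cc_FTC cF ler01 dF) k10 mulrBl.
have -> : \int[mu]_(t in I01) (g t * (expR (w t) * k t))
    + \int[mu]_(t in I01) (expR (w t) * dk t) =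
  \int[mu]_(t in I01) (g t * ((expR (w t) - expR (v t)) * k t))
  + \int[mu]_(t in I01) ((g t - g1 t) * (expR (v t) * k t))
  + \int[mu]_(t in I01) ((expR (w t) - expR (v t)) * dk t)
  + (expR (v 1) - expR (v 0)) * k 0.
  rewrite -FTC.
  have -> : \int[mu]_(t in I01) (g t * ((expR (w t) - expR (v t)) * k t)) =
      \int[mu]_(t in I01) (g t * (expR (w t) * k t))
      - \int[mu]_(t in I01) (g t * (expR (v t) * k t)).
    rewrite -RintegralB //.
    - by apply: eq_Rintegral => t _; rewrite mulrBl mulrBr.
    - exact: (integrable_mul_continuous ig (cM _ _ cew ck)).
    - exact: (integrable_mul_continuous ig (cM _ _ cev ck)).
  have -> : \int[mu]_(t in I01) ((g t - g1 t) * (expR (v t) * k t)) =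
      \int[mu]_(t in I01) (g t * (expR (v t) * k t))
      - \int[mu]_(t in I01) (g1 t * (expR (v t) * k t)).
    rewrite -RintegralB //.
    - by apply: eq_Rintegral => t _; rewrite mulrBl.
    - exact: (integrable_mul_continuous ig (cM _ _ cev ck)).
    - exact: (integrable_mul_continuous ig1 (cM _ _ cev ck)).
  have -> : \int[mu]_(t in I01) ((expR (w t) - expR (v t)) * dk t) =
      \int[mu]_(t in I01) (expR (w t) * dk t)
      - \int[mu]_(t in I01) (expR (v t) * dk t).
    rewrite -RintegralB //.
    - by apply: eq_Rintegral => t _; rewrite mulrBl.
    - exact: (integrable_continuous (cM _ _ cew cdk)).
    - exact: (integrable_continuous (cM _ _ cev cdk)).
  by ring.
have cd := cB _ _ cew cev.
have B1 : `|\int[mu]_(t in I01) (g t * ((expR (w t) - expR (v t)) * k t))|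
    <= n1 * (E * e * M).
  apply: Rintegral_mul_le => //.
    exact: (integrable_mul_continuous ig (cM _ _ cd ck)).
  by move=> t It; rewrite normrM; apply: ler_pM => //; [exact: Ewv|exact: HM].
have B2 : `|\int[mu]_(t in I01) ((g t - g1 t) * (expR (v t) * k t))|
    <= e * (E * M).
  apply: (@le_trans _ _ ((\int[mu]_(t in I01) `|g t - g1 t|) * (E * M))).
    apply: Rintegral_mul_le => //.
      exact: (integrable_mul_continuous igg (cM _ _ cev ck)).
    move=> t It; rewrite normrM ger0_norm ?expR_ge0 //.
    by apply: ler_pM => //; rewrite ?expR_ge0 //; [exact: Ev|exact: HM].
  by rewrite ler_wpM2r // mulr_ge0.
have B3 : `|\int[mu]_(t in I01) ((expR (w t) - expR (v t)) * dk t)|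
    <= E * e * N.
  rewrite -[leRHS]mulr1 -[X in _ <= _ * X](subr0 (1 : R)).
  apply: Rintegral_cc_bound => //; first exact: (cM _ _ cd cdk).
  move=> t It; rewrite normrM; apply: ler_pM => //; [exact: Ewv|exact: HN].
have B4 : `|(expR (v 1) - expR (v 0)) * k 0| <= E * e * M.
  rewrite normrM; apply: ler_pM => //; last exact: (HM _ unit_interval0).
  have [_ v1] := wB _ unit_interval1; have [_ v0] := wB _ unit_interval0.
  apply: le_trans (expR_lipschitz v1 v0) _; rewrite ler_wpM2l //.
  (* As [g] has mean 0, the uniform estimate at 1 reads |G 1| <= e: the approximation v is almost
     periodic, which bounds the boundary term. *)
  have := HW 1 unit_interval1; rewrite g0 sub0r normrN.
  by rewrite /v G0 addr0 addrAC subrr add0r.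
move: B1 B2 B3 B4.
set X1 := \int[mu]_(t in I01) _; set X2 := \int[mu]_(t in I01) _.
set X3 := \int[mu]_(t in I01) _; set X4 := (_ - _) * k 0 => B1 B2 B3 B4.
have := ler_normD (X1 + X2 + X3) X4; have := ler_normD (X1 + X2) X3.
have := ler_normD X1 X2.
lra.
Qed.

End weak_exponential.

(** * The action of a composition *)

Section postcomposition.
Context {R : realType}.
Notation mu := (@lebesgue_measure R).
Notation I01 := (unit_interval R).
Implicit Types (f g h k w phi psi : R -> R) (t : R).

Lemma weak_derivativeP w g : is_weak_derivative w g ->
  is_weak_derivative w (weak_derivative w).
Proof.
by move=> wg; rewrite /weak_derivative; case: xgetP => // /(_ g).
Qed.

Lemma circle_L2_continuous f : continuous f -> circle_L2 f.
Proof.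
move=> cf; split; first by have [] := measurable_bounded_continuous cf.
have cff : continuous (fun t => f t ^+ 2) by move=> t; apply: cvgM; exact: cf.
exact: (integrable_continuous cff).
Qed.

Lemma circle_L2_ae f g : circle_L2 f ->
  measurable_fun (I01 : set (measurableTypeR R)) g ->
  {ae mu, forall t, I01 t -> g t = f t} -> circle_L2 g.
Proof.
move=> [mf if2] mg fg; split=> //; have mI := @measurable_unit_interval R.
have mg2 : measurable_fun (I01 : set (measurableTypeR R)) (fun t => (g t ^+ 2)%:E).
  by apply/measurable_EFinP; exact: measurable_funX.
have mf2 : measurable_fun (I01 : set (measurableTypeR R)) (fun t => (f t ^+ 2)%:E).
  by apply/measurable_EFinP; exact: measurable_funX.
apply/integrableP; split=> //.
have /integrableP[_] := if2; apply: le_lt_trans.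
rewrite le_eqVlt; apply/orP; left; apply/eqP; apply: ae_eq_integral => //.
- exact: measurableT_comp.
- exact: measurableT_comp.
- apply: filterS fg; first exact: (ae_filter_ringOfSetsType mu).
  by move=> t H It /=; rewrite H.
Qed.

Lemma circle_L2_addc f h : mu.-integrable I01 (EFin \o f) -> circle_L2 f ->
  continuous h -> circle_L2 (fun t => f t + h t).
Proof.
move=> i_f [mf if2] ch; have mI := @measurable_unit_interval R.
have [mh _] := measurable_bounded_continuous ch.
split; first exact: measurable_funD.
have ch2 : continuous (fun t => 2 * h t).
  by move=> t; apply: cvgM; [exact: cvg_cst|exact: ch].
have chh : continuous (fun t => h t ^+ 2).
  by move=> t; apply: cvgM; exact: ch.
have i1 := integrable_mul_continuous i_f ch2.
have i2 := integrable_continuous chh.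
have := integrableD mI (integrableD mI if2 i1) i2.
apply: eq_integrable => // t _ /=.
by rewrite -!EFinD; congr (_%:E); ring.
Qed.

Lemma actionE phi : H_diffeo phi -> action phi =
  ((2^-1)%:E * \int[mu]_(t in I01)
    ((weak_derivative (log_deriv phi) t) ^+ 2
      - 4 * pi ^+ 2 * (derive1 phi t) ^+ 2)%:E)%E.
Proof. by move=> Hphi; rewrite /action asboolT. Qed.

(** Here P = psi' and M is its logarithmic derivative. Beyond regularity and positivity, what is
    used of [psi] is periodicity, which removes the boundary terms, and the Schwarzian identity
    [ident]. *)
Lemma postcomp_action psi phi (P M dM : R -> R) :
  (forall t : R, is_derive t (1 : R) psi (P t)) ->
  (forall t, psi (t + 1) = psi t + 1) -> (forall t, 0 < P t) ->
  (forall t : R, is_derive t (1 : R) (fun t => ln (P t)) (M t)) ->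
  (forall t : R, is_derive t (1 : R) M (dM t)) -> continuous dM ->
  continuous P -> periodic1 P -> periodic1 M ->
  (forall t, M t ^+ 2 - 2 * dM t = 4 * pi ^+ 2 * (P t ^+ 2 - 1)) ->
  H_diffeo phi -> action (psi \o phi) = action phi.
Proof.
move=> dpsi psi1 P0 dL dMP cdM cP pP pM ident Hphi.
have mI := @measurable_unit_interval R.
have [[dphi cp phi1 p0] [pw L2w [g1 wg1 L2g1]]] := Hphi.
pose p := derive1 phi; pose w := log_deriv phi.
have pE t : expR (w t) = p t by rewrite /w /log_deriv lnK // posrE.
have dphi' (t : R) : is_derive t (1 : R) phi (p t).
  by rewrite /p derive1E; apply: DeriveDef => //; exact: dphi.
have cphi := is_derive_continuous dphi'.
have cw : continuous w.
  move=> t; apply: (@continuous_comp _ _ _ (derive1 phi) (@ln R)); first exact: cp.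
  by apply: continuous_ln; exact: p0.
pose g := weak_derivative w.
have wg : is_weak_derivative w g := weak_derivativeP wg1.
have [ig _] := wg.
have mg : measurable_fun (I01 : set (measurableTypeR R)) g.
  by apply/measurable_EFinP; exact: (measurable_int mu ig).
(* Membership in H^1 supplies some square integrable weak derivative; the one chosen by
   [weak_derivative] agrees with it almost everywhere. *)
have L2g : circle_L2 g.
  by apply: (circle_L2_ae L2g1 mg); exact: weak_derivative_unique wg wg1.
have dcomp (f df : R -> R) : (forall t : R, is_derive t (1 : R) f (df t)) ->
    forall t : R, is_derive t (1 : R) (fun t => f (phi t)) (df (phi t) * p t).
  by move=> df' t; exact: (@is_derive1_comp R f phi t _ _ (df' _) (dphi' t)).
have cc (f : R -> R) : continuous f -> continuous (fun t => f (phi t)).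
  by move=> cf t; apply: continuous_comp; [exact: cphi|exact: cf].
have cMul (f h : R -> R) : continuous f -> continuous h ->
    continuous (fun t => f t * h t).
  by move=> cf ch t; apply: cvgM; [exact: cf|exact: ch].
have cAdd (f h : R -> R) : continuous f -> continuous h ->
    continuous (fun t => f t + h t).
  by move=> cf ch t; apply: cvgD; [exact: cf|exact: ch].
have cL := is_derive_continuous dL; have cM := is_derive_continuous dMP.
have pphi (f : R -> R) : periodic1 f -> periodic1 (fun t => f (phi t)).
  by move=> pf t; rewrite phi1 pf.
have dpsiphi : derive1 (psi \o phi) = fun t => P (phi t) * p t.
  by apply: is_derive_derive1; exact: dcomp.
have pp : periodic1 p.
  move=> t; apply: ln_inj; rewrite ?posrE ?p0 //; exact: pw.
pose l t := ln (P (phi t)); pose dl t := M (phi t) * p t.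
have dlP : forall t : R, is_derive t (1 : R) l (dl t) by exact: dcomp.
have cl := is_derive_continuous dlP.
have cdl : continuous dl by exact: (cMul _ _ (cc _ cM) cp).
have logE : log_deriv (psi \o phi) = fun t => w t + l t.
  apply/funext => t; rewrite /log_deriv dpsiphi lnM ?posrE ?p0 //.
  by rewrite addrC.
have wg2 : is_weak_derivative (log_deriv (psi \o phi)) (fun t => g t + dl t).
  split; first by have := integrableD mI ig (integrable_continuous cdl).
  move=> chi tchi; have cchi : continuous chi.
    move=> t; apply: differentiable_continuous; apply/derivable1_diffP.
    exact: (tchi.2 0%N t).
  have dchi (t : R) : is_derive t (1 : R) chi (derive1 chi t).
    by rewrite derive1E; apply: DeriveDef => //; exact: (tchi.2 0%N t).
  have cdchi : continuous (derive1 chi).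
    move=> t; apply: differentiable_continuous; apply/derivable1_diffP.
    by have := tchi.2 1%N t; rewrite derive1n1.
  (* Classical integration by parts, as l is C^1; the boundary terms cancel because l and chi are
     periodic. *)
  have ibp : \int[mu]_(t in I01) (l t * derive1 chi t) +
      \int[mu]_(t in I01) (dl t * chi t) = 0.
    rewrite -RintegralD //; try exact: (integrable_continuous (cMul _ _ _ _)).
    have cF := cAdd _ _ (cMul _ _ cl cdchi) (cMul _ _ cdl cchi).
    have dF (t : R) : is_derive t (1 : R) (fun t => l t * chi t)
        (l t * derive1 chi t + dl t * chi t).
      by apply: (is_derive_eq (is_deriveM (dlP t) (dchi t)));
        rewrite /GRing.scale /=; ring.
    rewrite (Rintegral_cc_FTC cF ler01 dF) -[1]add0r tchi.1 /l phi1 pP.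
    exact: subrr.
  rewrite logE; under eq_Rintegral do rewrite mulrDl.
  rewrite RintegralD //; try exact: (integrable_continuous (cMul _ _ _ _)).
  under [in RHS]eq_Rintegral do rewrite mulrDl.
  rewrite [in RHS]RintegralD //; last 2 first.
  - exact: integrable_mul_continuous.
  - exact: (integrable_continuous (cMul _ _ _ _)).
  by rewrite (wg.2 _ tchi); move: ibp => /eqP; rewrite addr_eq0 => /eqP ->; ring.
have Hpsiphi : H_diffeo (psi \o phi).
  split.
    split.
    - by move=> t; have [] := dcomp _ _ dpsi t.
    - by rewrite dpsiphi; exact: (cMul _ _ (cc _ cP) cp).
    - by move=> t /=; rewrite phi1 psi1.
    - by move=> t; rewrite dpsiphi mulr_gt0.
  split.
  - by move=> t; rewrite /log_deriv dpsiphi (pphi _ pP) pp.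
  - by apply: circle_L2_continuous; rewrite logE; exact: cAdd.
  - by exists (fun t => g t + dl t) => //; exact: circle_L2_addc.
rewrite (actionE Hpsiphi) (actionE Hphi); apply: (congr1 (mule _)).
(* The weak derivative chosen for the composition is replaced, up to a null set, by the explicit g +
   dl. *)
have g2E := weak_derivative_unique (weak_derivativeP wg2) wg2.
set g2 := weak_derivative _ in g2E *.
rewrite -/w -/g -/p dpsiphi.
pose q t := P (phi t) * p t.
have cq : continuous q by exact: (cMul _ _ (cc _ cP) cp).
pose c2 : R := 4 * pi ^+ 2.
have cc2 : continuous (fun _ : R => c2) by move=> t; exact: cvg_cst.
have cX (f : R -> R) : continuous f -> continuous (fun t => f t ^+ 2).
  by move=> cf t; apply: cvgM; exact: cf.
have iA : mu.-integrable I01 (EFin \o (fun t => g t ^+ 2 - c2 * p t ^+ 2)).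
  by have := integrableB mI L2g.2 (integrable_continuous (cMul _ _ cc2 (cX _ cp))).
have L2gd := circle_L2_addc ig L2g cdl.
have iB : mu.-integrable I01 (EFin \o (fun t => (g t + dl t) ^+ 2 - c2 * q t ^+ 2)).
  by have := integrableB mI L2gd.2 (integrable_continuous (cMul _ _ cc2 (cX _ cq))).
have mg2 : measurable_fun (I01 : set (measurableTypeR R)) g2.
  apply/measurable_EFinP.
  by have [] := weak_derivativeP wg2 => /(measurable_int mu).
transitivity (\int[mu]_(t in I01) ((g t + dl t) ^+ 2 - c2 * q t ^+ 2)%:E)%E.
  apply: ae_eq_integral => //.
  - apply/measurable_EFinP; apply: measurable_funB; first exact: measurable_funX.
    by have [] := measurable_bounded_continuous (cMul _ _ cc2 (cX _ cq)).
  - exact: (measurable_int mu iB).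
  - apply: filterS g2E; first exact: (ae_filter_ringOfSetsType mu).
    by move=> t H It; rewrite H.
have RE (f : R -> R) : mu.-integrable I01 (EFin \o f) ->
    (\int[mu]_(t in I01) (f t)%:E)%E = (\int[mu]_(t in I01) f t)%:E.
  by move=> i_f; rewrite /Rintegral fineK //; apply: integrable_fin_num.
rewrite (RE _ iA) (RE _ iB); congr (_%:E).
(* The cross term 2 g M(phi) p is 2 g e^w k, the shape handled by [weak_derivative_expR]. *)
pose k t := M (phi t); pose dk t := dM (phi t) * p t.
have dkP : forall t : R, is_derive t (1 : R) k (dk t) by exact: dcomp.
have cdk : continuous dk by exact: (cMul _ _ (cc _ cdM) cp).
have k10 : k 1 = k 0 by rewrite /k -[1]add0r phi1 pM.
have := weak_derivative_expR cw wg cdk dkP k10.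
under eq_Rintegral do rewrite pE.
under [in RHS]eq_Rintegral do rewrite pE.
move=> main.
have ck := is_derive_continuous dkP.
have cr : continuous (fun t => 2 * (p t * dk t)).
  by move=> t; apply: cvgM; [exact: cvg_cst|exact: (cMul _ _ cp cdk)].
have ipk : mu.-integrable I01 (EFin \o (fun t => 2 * (g t * (p t * k t)))).
  have ck2 : continuous (fun t => 2 * (p t * k t)).
    by move=> t; apply: cvgM; [exact: cvg_cst|exact: (cMul _ _ cp ck)].
  have := integrable_mul_continuous ig ck2; apply: eq_integrable => // t _ /=.
  by congr (_%:E); ring.
(* Expanding the square and substituting [ident] at phi t leaves 2 g p k + 2 p dk beyond the
   original integrand; its integral is 0 by [main]. *)
transitivity (\int[mu]_(t in I01) (g t ^+ 2 - c2 * p t ^+ 2) +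
  (\int[mu]_(t in I01) (2 * (g t * (p t * k t)))
    + \int[mu]_(t in I01) (2 * (p t * dk t)))).
  rewrite -RintegralD //; last exact: integrable_continuous.
  rewrite -RintegralD //; last first.
    by have := integrableD mI ipk (integrable_continuous cr).
  apply: eq_Rintegral => t _; rewrite /q /dl /k /dk.
  have := ident (phi t); rewrite -/c2.
  move: (P (phi t)) (M (phi t)) (dM (phi t)) (p t) (g t) => x y z u v h.
  have -> : c2 * (x * u) ^+ 2 = (c2 * (x ^+ 2 - 1)) * u ^+ 2 + c2 * u ^+ 2 by ring.
  by rewrite -h; ring.
rewrite RintegralZl //; last exact: (integrable_mul_continuous ig (cMul _ _ cp ck)).
rewrite [X in _ + (_ + X)]RintegralZl //; last first.
  exact: (integrable_continuous (cMul _ _ cp cdk)).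
by rewrite main mulrN addNr addr0.
Qed.

End postcomposition.

(** * The Schwarzian identity for the Poisson kernel *)

Section poisson_kernel.
Context {R : realType}.
Local Notation C := (R[i]^o).
Implicit Types (a : C) (t : R).

Let dden a t : R :=
  2 * pi * (2 * complex.Re a * sin (2 * pi * t) - 2 * complex.Im a * cos (2 * pi * t)).
Let ddden a t : R := (2 * pi) ^+ 2 *
  (2 * complex.Re a * cos (2 * pi * t) + 2 * complex.Im a * sin (2 * pi * t)).

Lemma is_derive_cos2pi t :
  is_derive t (1 : R) (fun x => cos (2 * pi * x)) (- sin (2 * pi * t) * (2 * pi)).
Proof.
have := is_derive_cos_affine (2 * pi) 0 t.
by rewrite subr0; under eq_fun do rewrite subr0.
Qed.

Lemma is_derive_sin2pi t :
  is_derive t (1 : R) (fun x => sin (2 * pi * x)) (cos (2 * pi * t) * (2 * pi)).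
Proof.
have := is_derive_sin_affine (2 * pi) 0 t.
by rewrite subr0; under eq_fun do rewrite subr0.
Qed.

Lemma is_derive_poisson_den a t :
  is_derive t (1 : R) (poisson_den a) (dden a t).
Proof.
have hc := is_derive_cos2pi t; have hs := is_derive_sin2pi t.
by apply: is_derive_eq; rewrite /dden /GRing.scale /=; ring.
Qed.

Lemma is_derive_dden a t : is_derive t (1 : R) (dden a) (ddden a t).
Proof.
have hc := is_derive_cos2pi t; have hs := is_derive_sin2pi t.
by apply: is_derive_eq; rewrite /ddden /GRing.scale /=; ring.
Qed.

Lemma periodic_cos2pi t : cos (2 * pi * (t + 1)) = cos (2 * pi * t) :> R.
Proof. by rewrite mulrDr mulr1 mulr_natl (cosD2pi (pi *+ 2 * t)). Qed.

Lemma periodic_sin2pi t : sin (2 * pi * (t + 1)) = sin (2 * pi * t) :> R.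
Proof. by rewrite mulrDr mulr1 mulr_natl (sinD2pi (pi *+ 2 * t)). Qed.

(* [M = (ln P)'] for the Poisson kernel [P]; the identity says that the
   Schwarzian derivative of [tan (pi psi)] is that of [tan (pi t)]. *)
Lemma poisson_schwarzian a : modulus a < 1 ->
  let P t := (1 - modulus a ^+ 2) / poisson_den a t in
  exists M dM : R -> R, [/\ forall t : R, is_derive t (1 : R) (fun t => ln (P t)) (M t),
    forall t : R, is_derive t (1 : R) M (dM t), continuous dM, periodic1 M &
    forall t, M t ^+ 2 - 2 * dM t = 4 * pi ^+ 2 * (P t ^+ 2 - 1)].
Proof.
move=> a1 P; have D0 t : poisson_den a t != 0 by rewrite gt_eqF ?poisson_den_gt0.
have K0 : 0 < 1 - modulus a ^+ 2 by rewrite subr_gt0 sqr_modulus_lt1.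
have P0 t : 0 < P t by rewrite divr_gt0 // poisson_den_gt0.
have dV (t : R) := nf_is_deriveV (D0 t) (is_derive_poisson_den a t).
exists (fun t => - (dden a t / poisson_den a t)).
exists (fun t => (dden a t / poisson_den a t) ^+ 2 - ddden a t / poisson_den a t).
split.
- move=> t.
  have dP : is_derive t (1 : R) P
      ((1 - modulus a ^+ 2) * (- dden a t / poisson_den a t ^+ 2)).
    have := is_deriveM (is_derive_cst (1 - modulus a ^+ 2) t (1 : R)) (dV t).
    by move=> h; apply: (is_derive_eq h); rewrite /GRing.scale /= mulr0 addr0.
  have := @is_derive1_comp R (@ln R) P t _ _ (is_derive1_ln (P0 t)) dP.
  move=> h; apply: (is_derive_eq h); rewrite /P; field.
  by rewrite D0 gt_eqF.
- move=> t; have := is_deriveN (is_deriveM (is_derive_dden a t) (dV t)).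
  by move=> h; apply: (is_derive_eq h); rewrite /GRing.scale /=; field; exact: D0.
- have cD := is_derive_continuous (is_derive_poisson_den a).
  have cdD := is_derive_continuous (is_derive_dden a).
  have ccos := is_derive_continuous is_derive_cos2pi.
  have csin := is_derive_continuous is_derive_sin2pi.
  have cddD : continuous (ddden a).
    move=> t; apply: cvgM; first exact: cvg_cst.
    apply: cvgD; apply: cvgM; [exact: cvg_cst|exact: ccos|exact: cvg_cst|exact: csin].
  have cq (f : R -> R) : continuous f -> continuous (fun t => f t / poisson_den a t).
    by move=> cf t; apply: cvgM; [exact: cf|apply: cvgV; [exact: D0|exact: cD]].
  move=> t; apply: cvgB; last exact: cq.
  by apply: cvgM; exact: cq.
- by move=> t; rewrite /dden /poisson_den periodic_cos2pi periodic_sin2pi.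
- move=> t; set c := cos (2 * pi * t); set s := sin (2 * pi * t).
  have cs : s ^+ 2 = 1 - c ^+ 2 by rewrite /s sin2cos2.
  rewrite /P; have := D0 t; set D := poisson_den a t => Dt.
  (* With D the denominator, M = - D'/D, so M^2 - 2 M' = (2 D'' D - D'^2) / D^2. Clearing D^2 leaves
     a polynomial identity in c and s modulo s^2 = 1 - c^2. *)
  have key : dden a t ^+ 2 + 2 * (ddden a t * D - dden a t ^+ 2) =
      4 * pi ^+ 2 * ((1 - modulus a ^+ 2) ^+ 2 - D ^+ 2).
    rewrite /D /dden /ddden /poisson_den -/c -/s sqr_modulus.
    move: cs; case: (a) => a1' a2 /= cs.
    ring: cs.
  transitivity ((dden a t ^+ 2 + 2 * (ddden a t * D - dden a t ^+ 2)) / D ^+ 2).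
    by field.
  by rewrite key; field.
Qed.

End poisson_kernel.

Theorem proposition7 (R : realType) (psi phi : R -> R)
  (hpsi : PSL2R psi) (hphi : H_diffeo phi) :
  action (psi \o phi) = action phi.
Proof.
have [a [c [a1 c1 H]]] := PSL2R_moebius hpsi.
have cpsi := hpsi.1.
have dpsi := PSL2R_derive cpsi a1 c1 H.
have [M [dM [dL dMP cdM pM ident]]] := poisson_schwarzian a1.
apply: (postcomp_action dpsi (PSL2R_translation cpsi a1 c1 H) _ dL dMP cdM) => //.
- by move=> t; rewrite divr_gt0 ?poisson_den_gt0 // subr_gt0 sqr_modulus_lt1.
- move=> t; apply: cvgM; first exact: cvg_cst.
  apply: cvgV; first by rewrite gt_eqF ?poisson_den_gt0.
  exact: (is_derive_continuous (is_derive_poisson_den a)).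
- by move=> t; rewrite /poisson_den periodic_cos2pi periodic_sin2pi.
Qed.
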